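(* Let $f:\mathbb{R}^d\to\mathbb{R}$ be twice differentiable, strongly convex with parameter $\mu>0$, with gradient Lipschitz continuous with parameter $L>0$ (so $\mu\|x-y\|\le\|\nabla f(x)-\nabla f(y)\|\le L\|x-y\|$ for all $x,y\in\mathbb{R}^d$). Let $x_*$ be its unique minimizer, and suppose that for some constant $M\ge 0$, $\|\nabla^2 f(x)-\nabla^2 f(x_* )\|\le M\|x-x_*\|$ for all $x\in\mathbb{R}^d$. Let $\{x_k\}_{k\ge0}$ be the iterates generated by the convex Broyden class of quasi-Newton methods (see context) with parameters $\phi_k\in[0,1]$, initial point $x_0$ and initial symmetric positive-definite Hessian approximation $B_0$. Suppose $$\frac{M}{\mu^{3/2}}\|\nabla^{2}f(x_* )^{\frac12}(x_0 - x_* )\| \leq \epsilon, \qquad \|\nabla^{2}f(x_* )^{-\frac{1}{2}} (B_0 - \nabla^{2}f(x_* ))\nabla^{2}f(x_* )^{-\frac{1}{2}}\|_F \leq \delta,$$ where $\epsilon,\delta\in(0,\frac12)$ are such that for some $\rho\in(0,1)$, $$\max_{k \geq 0}\left[\phi_k(2\delta + 1)\frac{4}{(1 - \epsilon)^2} + \frac{3 + \epsilon}{1 - \epsilon}\right]\frac{\epsilon}{1 - \rho} \leq \delta, \qquad \frac{\epsilon}{2} + 2\delta \leq (1 - 2\delta)\rho .$$ Then $\{x_k\}$ converges to $x_*$ at the superlinear rate: for all $k\ge1$, $$\frac{\|\nabla^{2}f(x_* )^\frac{1}{2}(x_k - x_* )\|}{\|\nabla^{2}f(x_* )^\frac{1}{2}(x_0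 - x_* )\|} \leq \left(\frac{2\sqrt{2}\,\delta(1 + \rho)(1 + \frac{\epsilon}{2})q\sqrt{k} + \frac{(1 + \rho)(1 + \frac{\epsilon}{2})\epsilon}{2(1 - \rho)}}{k}\right)^k,$$ $$\frac{f(x_k) - f(x_* )}{f(x_0) - f(x_* )} \leq \left(1 + \frac{\epsilon}{2}\right)^2\left(\frac{2\sqrt{2}\,\delta(1 + \rho)(1 + \frac{\epsilon}{2})q\sqrt{k} + \frac{(1 + \rho)(1 + \frac{\epsilon}{2})\epsilon}{2(1 - \rho)}}{k}\right)^{2k},$$ where $q = \max_{k \geq 0}\sqrt{\frac{1}{\phi_k + (1 - \phi_k)\frac{1 - 2\delta}{1 + 2\delta}}} \in \left[1, \sqrt{\frac{1 + 2\delta}{1 - 2\delta}}\right]$.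
   Context: Convex Broyden class of quasi-Newton methods (unit step size): given $x_0\in\mathbb{R}^d$, a symmetric positive-definite $B_0\in\mathbb{R}^{d\times d}$ and parameters $\phi_k\in[0,1]$, for $k=0,1,2,\dots$ set $x_{k+1}=x_k-B_k^{-1}\nabla f(x_k)$, $s_k=x_{k+1}-x_k$, $y_k=\nabla f(x_{k+1})-\nabla f(x_k)$, and $B_{k+1}=\phi_k B^{DFP}_{k+1}+(1-\phi_k)B^{BFGS}_{k+1}$, where $$B^{DFP}_{k+1} = \left(I-\frac{y_k s_k^\top}{y_k^\top s_k}\right) B_k \left(I-\frac{ s_ky_k^\top}{s_k^\top y_k}\right) +\frac{y_k y_k^\top}{y_k^\top s_k},\qquad B^{BFGS}_{k+1} = B_k - \frac{B_k s_k s_k^\top B_k}{s_k^\top B_k s_k} + \frac{y_k y_k^\top}{s_k^\top y_k}.$$ The algorithm terminates if $s_k=0$ (in which case $x_k=x_*$); it is assumed throughout that $s_k\ne0$ for all $k$. Then $s_k^\top y_k>0$ and all $B_k$ are symmetric positive-definite. $\|\cdot\|$ is the Euclidean norm of vectors and the induced 2-norm of matrices, $\|\cdot\|_F$ is the Frobenius norm, and $A^{1/2},A^{-1/2}$ denote the symmetric positive-definite square roots of $A$ and $A^{-1}$. The maxima over $k\ge0$ are understood as suprema. *)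

(* Defs.v *)
From HB Require Import structures.
From mathcomp Require Import all_boot all_order all_algebra.
From mathcomp Require Import all_classical all_reals all_analysis.

Set Implicit Arguments.
Unset Strict Implicit.
Unset Printing Implicit Defensive.

Import Order.TTheory GRing.Theory Num.Theory.
Import numFieldNormedType.Exports.
Local Open Scope classical_set_scope.
Local Open Scope ring_scope.

(** R^d is the type of column vectors ['cV[R]_d].  The norm [`|x|] that the
    library puts on it is the sup norm.  The topology and Fréchet
    differentiability do not depend on that choice, but the estimates do, so
    they use [enorm], [opnorm] and [frobenius] below. *)

Section LinearAlgebra.
Context {R : realType}.

Definition vdot d (u v : 'cV[R]_d) : R := (u^T *m v) ord0 ord0.

Definition enorm d (u : 'cV[R]_d) : R := Num.sqrt (vdot u u).

Definition opnorm d (A : 'M[R]_d) : R :=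
  sup [set enorm (A *m v) | v in [set v : 'cV[R]_d | enorm v <= 1]].

Definition frobenius d (A : 'M[R]_d) : R :=
  Num.sqrt (\sum_(i < d) \sum_(j < d) A i j ^+ 2).

Definition posdefmx d (A : 'M[R]_d) : Prop :=
  A^T = A /\ forall v : 'cV[R]_d, v != 0 -> 0 < vdot v (A *m v).

(** The default value 0 is irrelevant when [A] is symmetric positive definite:
    there is then exactly one such [S]. *)
Definition sqrtmx d (A : 'M[R]_d) : 'M[R]_d :=
  xget 0 [set S | posdefmx S /\ S *m S = A].

End LinearAlgebra.

Section Calculus.
Context {R : realType}.

Definition gradient d (f : 'cV[R]_d -> R) (x : 'cV[R]_d) : 'cV[R]_d :=
  \col_(i < d) 'D_(delta_mx i ord0) f x.

Definition hessian d (f : 'cV[R]_d -> R) (x : 'cV[R]_d) : 'M[R]_d :=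
  \matrix_(i < d, j < d)
    'D_(delta_mx j ord0) (fun z => gradient f z i ord0) x.

(** Fréchet differentiability of [f] and of its gradient; the second
    derivative is not assumed continuous. *)
Definition twice_differentiable d (f : 'cV[R]_d -> R) : Prop :=
  (forall x, differentiable f x) /\ (forall x, differentiable (gradient f) x).

Definition strongly_convex d (mu : R) (f : 'cV[R]_d -> R) : Prop :=
  forall (x y : 'cV[R]_d) (t : R), 0 <= t <= 1 ->
    f (t *: x + (1 - t) *: y) <=
      t * f x + (1 - t) * f y - mu / 2 * t * (1 - t) * enorm (x - y) ^+ 2.

Definition gradient_lipschitz d (L : R) (f : 'cV[R]_d -> R) : Prop :=
  forall x y : 'cV[R]_d,
    enorm (gradient f x - gradient f y) <= L * enorm (x - y).

End Calculus.

Section Broyden.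
Context {R : realType}.

Definition dfp_update d (B : 'M[R]_d) (s y : 'cV[R]_d) : 'M[R]_d :=
  (1%:M - (vdot y s)^-1 *: (y *m s^T)) *m B
    *m (1%:M - (vdot s y)^-1 *: (s *m y^T))
  + (vdot y s)^-1 *: (y *m y^T).

Definition bfgs_update d (B : 'M[R]_d) (s y : 'cV[R]_d) : 'M[R]_d :=
  B - (vdot s (B *m s))^-1 *: (B *m s *m s^T *m B)
    + (vdot s y)^-1 *: (y *m y^T).

Definition broyden_update d (phi : R) (B : 'M[R]_d) (s y : 'cV[R]_d) :
    'M[R]_d :=
  phi *: dfp_update B s y + (1 - phi) *: bfgs_update B s y.

(** [invmx B = B] by convention when [B] is singular; this does not occur
    along the iteration, where every [B k] is positive definite. *)
Definition broyden_iterates d (f : 'cV[R]_d -> R) (phi : nat -> R)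
    (x : nat -> 'cV[R]_d) (B : nat -> 'M[R]_d) : Prop :=
  forall k : nat,
    x k.+1 = x k - invmx (B k) *m gradient f (x k) /\
    B k.+1 = broyden_update (phi k) (B k) (x k.+1 - x k)
               (gradient f (x k.+1) - gradient f (x k)).

End Broyden.

(* Main.v *)
Require Import Defs.
From HB Require Import structures.
From mathcomp Require Import all_boot all_order all_algebra.
From mathcomp Require Import all_classical all_reals all_analysis.
From mathcomp Require Import complex ring lra.

Set Implicit Arguments.
Unset Strict Implicit.
Unset Printing Implicit Defensive.

Import Order.TTheory GRing.Theory Num.Theory.
Import numFieldNormedType.Exports.
Local Open Scope classical_set_scope.
Local Open Scope ring_scope.

(** Write [H] for the Hessian at the minimizer [xs].  In the coordinates
    [r k = H^(1/2) (x k - xs)], with gradients [g k = H^(-1/2) (gradient f (x k))]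
    and matrices [H^(-1/2) B k H^(-1/2)], the iteration is again a Broyden
    iteration ([broyden_update_congr]), and its ideal matrix is the identity.

    The Lipschitz bound on the Hessian makes the gradient nearly linear there:
    with [c = M / mu^(3/2)], both [g k - r k] and [y k - s k] are of relative
    size [c |r k|] ([preconditioned_gradient], [preconditioned_secant]).  If the
    secant pair were exact, [y = s], an update could only bring [B] closer to
    the identity in the Frobenius norm, and the squared distance would drop by
    at least a fixed multiple of [theta^2], where
    [theta = |(B - I) s| / |s|] ([dfp_update_exact], [bfgs_update_exact]).
    An inexact pair costs an additional term proportional to [c |r k|]
    ([broyden_update_contract]).

    These facts feed each other.  As long as [B k] is within [2 delta] of the
    identity, the step contracts the error by [rho]; then the perturbations
    [c |r k|] are summable, and the first condition on the constants says that
    their total moves [B k] by at most [delta].  The same balance bounds the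
    sum of all [theta k ^ 2] by [8 delta^2 q^2] ([iteration_invariant]).  Since
    the error ratio at step [k] is at most [(1 + rho) theta k + c |r k| / 2],
    the ratios have a sum of order [sqrt k], and the arithmetic-geometric mean
    inequality bounds their product by the announced [k]-th power
    ([iteration_superlinear_rate]).

    The estimate on [f] follows from [f x - f xs = |r|^2 / 2] up to a relative
    error of order [c |r|] ([preconditioned_value]).  Every integral remainder
    is replaced by the mean value theorem on a segment ([increment_le]). *)

(** * The Frobenius inner product *)

Section FrobeniusInnerProduct.
Context {R : realType}.

(** The trace pairing is taken on rectangular matrices, so that columns and
    square matrices share one theory: [mnorm] is the Euclidean norm on the
    former and the Frobenius norm on the latter. *)
Definition mdot m n (A B : 'M[R]_(m, n)) : R := \tr (A^T *m B).
Definition mnorm m n (A : 'M[R]_(m, n)) : R := Num.sqrt (mdot A A).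

Section Shape.
Context {m n : nat}.
Implicit Types A B C : 'M[R]_(m, n).

Lemma mdotE A B : mdot A B = \sum_i \sum_j A i j * B i j.
Proof.
rewrite /mdot exchange_big; apply: eq_bigr => j _; rewrite mxE.
by apply: eq_bigr => i _; rewrite mxE.
Qed.

Lemma mdotC A B : mdot A B = mdot B A.
Proof. by rewrite /mdot -mxtrace_tr trmx_mul trmxK. Qed.

Lemma mdotDr A B C : mdot A (B + C) = mdot A B + mdot A C.
Proof. by rewrite /mdot mulmxDr mxtraceD. Qed.

Lemma mdotZr a A B : mdot A (a *: B) = a * mdot A B.
Proof. by rewrite /mdot -scalemxAr mxtraceZ. Qed.

Lemma mdotNr A B : mdot A (- B) = - mdot A B.
Proof. by rewrite -scaleN1r mdotZr mulN1r. Qed.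

Lemma mdotDl A B C : mdot (A + B) C = mdot A C + mdot B C.
Proof. by rewrite mdotC mdotDr !(mdotC C). Qed.

Lemma mdotZl a A B : mdot (a *: A) B = a * mdot A B.
Proof. by rewrite mdotC mdotZr mdotC. Qed.

Lemma mdotNl A B : mdot (- A) B = - mdot A B.
Proof. by rewrite mdotC mdotNr mdotC. Qed.

Lemma mdot_ge0 A : 0 <= mdot A A.
Proof.
by rewrite mdotE; do 2!(apply: sumr_ge0 => ? _); rewrite -expr2 sqr_ge0.
Qed.

Lemma mdot_eq0 A : (mdot A A == 0) = (A == 0).
Proof.
apply/eqP/eqP => [A0|->]; last by rewrite -[0](scale0r 0) mdotZl mul0r.
apply/matrixP => i j; rewrite mxE; move: A0.
rewrite mdotE pair_bigA /= => /psumr_eq0P A0.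
apply/eqP; rewrite -sqrf_eq0 expr2; apply/eqP.
by apply: (A0 _ (i, j)) => // p _; rewrite -expr2 sqr_ge0.
Qed.

Lemma mdot_gt0 A : A != 0 -> 0 < mdot A A.
Proof. by move=> A0; rewrite lt0r mdot_eq0 A0 mdot_ge0. Qed.

Lemma mdot_CauchySchwarz A B : mdot A B ^+ 2 <= mdot A A * mdot B B.
Proof.
have [->|B0] := eqVneq B 0.
  by rewrite -[0](scale0r 0) !mdotZr !mul0r mulr0 expr0n.
have Bgt0 := mdot_gt0 B0.
have := mdot_ge0 (mdot B B *: A - mdot A B *: B).
rewrite !(mdotDl, mdotDr, mdotNl, mdotNr, mdotZl, mdotZr) (mdotC B A).
set a := mdot A A; set b := mdot B B; set c := mdot A B => h.
rewrite -(ler_pM2l Bgt0) -/b -subr_ge0; apply: le_trans h _.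
by rewrite le_eqVlt; apply/orP; left; apply/eqP; ring.
Qed.

Lemma mnorm_ge0 A : 0 <= mnorm A.
Proof. exact: sqrtr_ge0. Qed.

Lemma mnorm_sqr A : mnorm A ^+ 2 = mdot A A.
Proof. by rewrite sqr_sqrtr // mdot_ge0. Qed.

Lemma mnorm_gt0 A : A != 0 -> 0 < mnorm A.
Proof. by move=> A0; rewrite sqrtr_gt0 mdot_gt0. Qed.

Lemma mnorm_le A c : 0 <= c -> mdot A A <= c ^+ 2 -> mnorm A <= c.
Proof.
by move=> c0 h; rewrite -(ler_pXn2r (ltn0Sn 1)) ?nnegrE ?mnorm_ge0// mnorm_sqr.
Qed.

Lemma mdot_le_norm A B : `|mdot A B| <= mnorm A * mnorm B.
Proof.
rewrite -(ler_pXn2r (ltn0Sn 1)) ?nnegrE ?mulr_ge0 ?mnorm_ge0//.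
by rewrite exprMn !mnorm_sqr -normrX ger0_norm ?sqr_ge0 // mdot_CauchySchwarz.
Qed.

Lemma mnormD A B : mnorm (A + B) <= mnorm A + mnorm B.
Proof.
apply: mnorm_le; first by rewrite addr_ge0 ?mnorm_ge0.
rewrite sqrrD !mnorm_sqr !(mdotDl, mdotDr) (mdotC B A).
have := le_trans (ler_norm _) (mdot_le_norm A B); lra.
Qed.

Lemma mnormZ a A : mnorm (a *: A) = `|a| * mnorm A.
Proof.
by rewrite /mnorm mdotZl mdotZr mulrA -expr2 sqrtrM ?sqr_ge0 // sqrtr_sqr.
Qed.

Lemma mnormN A : mnorm (- A) = mnorm A.
Proof. by rewrite /mnorm mdotNl mdotNr opprK. Qed.

Lemma mnormB A B : mnorm (A - B) <= mnorm A + mnorm B.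
Proof. by rewrite -(mnormN B) mnormD. Qed.

Lemma mnorm0 : mnorm (0 : 'M[R]_(m, n)) = 0.
Proof. by rewrite -[0](scale0r 0) mnormZ normr0 mul0r. Qed.

End Shape.

Lemma mdot_outer m n (x z : 'cV[R]_m) (y w : 'cV[R]_n) :
  mdot (x *m y^T) (z *m w^T) = mdot x z * mdot y w.
Proof.
rewrite /mdot trmx_mul trmxK mulmxA -[y *m _ *m _]mulmxA.
rewrite [x^T *m z]mx11_scalar mul_mx_scalar -scalemxAl mxtraceZ.
rewrite mxtrace_mulC; congr (_ * _); first by rewrite trace_mx11 [RHS]mxE mulr1n.
by rewrite -mxtrace_tr trmx_mul trmxK.
Qed.

Lemma mdot_outerr m n (A : 'M[R]_(m, n)) (x : 'cV[R]_m) (y : 'cV[R]_n) :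
  mdot A (x *m y^T) = mdot x (A *m y).
Proof.
by rewrite mdotC /mdot trmx_mul trmxK -mulmxA mxtrace_mulC mulmxA.
Qed.

Lemma mnorm_outer m n (x : 'cV[R]_m) (y : 'cV[R]_n) :
  mnorm (x *m y^T) = mnorm x * mnorm y.
Proof. by rewrite /mnorm mdot_outer sqrtrM ?mdot_ge0. Qed.

Lemma mdot_adj m n p (A : 'M[R]_(m, n)) (x : 'M[R]_(m, p)) y :
  mdot x (A *m y) = mdot (A^T *m x) y.
Proof. by rewrite /mdot trmx_mul trmxK mulmxA. Qed.

(** Pairing [A *m v] with itself amounts to pairing [A] with the rank-one
    matrix [(A *m v) *m v^T], so the bound is Cauchy-Schwarz for matrices. *)
Lemma mnorm_mulmx m n (A : 'M[R]_(m, n)) (v : 'cV[R]_n) :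
  mnorm (A *m v) <= mnorm A * mnorm v.
Proof.
have [->|Av0] := eqVneq (A *m v) 0.
  by rewrite mnorm0 mulr_ge0 ?mnorm_ge0.
rewrite -(ler_pM2l (mnorm_gt0 Av0)) -expr2 mnorm_sqr mulrCA -mnorm_outer.
by rewrite -mdot_outerr (le_trans (ler_norm _)) // mdot_le_norm.
Qed.

Lemma vdotE d (u v : 'cV[R]_d) : vdot u v = mdot u v.
Proof. by rewrite /mdot /mxtrace big_ord1. Qed.

Lemma enormE d (u : 'cV[R]_d) : enorm u = mnorm u.
Proof. by rewrite /enorm vdotE. Qed.

Lemma frobeniusE d (A : 'M[R]_d) : frobenius A = mnorm A.
Proof.
by rewrite /frobenius /mnorm mdotE.
Qed.

End FrobeniusInnerProduct.

(** * Square roots of positive definite matrices *)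

Section SquareRoot.
Context {R : realType}.
Local Notation toC := (@map_mx R R[i] (real_complex R) _ _).

(** Cyclicity of the trace and [X Y = - Y X] give [tr (Y X Y) = 0], hence
    [tr (Y^T X Y) = 0]; this trace is the sum of the values of the form [X] on
    the columns of [Y]. *)
Lemma anticommuting_skew_eq0 d (X Y : 'M[R]_d) :
  posdefmx X -> Y^T = - Y -> X *m Y + Y *m X = 0 -> Y = 0.
Proof.
move=> [_ Xpos] Yskew XY0.
have XYN : X *m Y = - (Y *m X) by apply/eqP; rewrite -addr_eq0 XY0.
have tr0 : \tr (Y^T *m X *m Y) = 0.
  have : \tr (Y *m X *m Y) = - \tr (Y *m X *m Y).
    by rewrite -{1}mulmxA mxtrace_mulC XYN mulNmx raddfN.
  rewrite Yskew !mulNmx raddfN; lra.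
have trE : \tr (Y^T *m X *m Y) = \sum_j vdot (col j Y) (X *m col j Y).
  apply: eq_bigr => j _; rewrite /vdot -mulmxA !mxE; apply: eq_bigr => k _.
  by rewrite !mxE; congr (_ * _); apply: eq_bigr => l _; rewrite !mxE.
have ge0 j : true -> 0 <= vdot (col j Y) (X *m col j Y).
  move=> _; have [->|/Xpos/ltW//] := eqVneq (col j Y) 0.
  by rewrite /vdot mulmx0 mulmx0 mxE.
apply/matrixP => i j; rewrite [RHS]mxE.
suff -> : Y i j = col j Y i ord0 by rewrite (_ : col j Y = 0) ?mxE//; 
  apply/eqP; apply: contraT => /Xpos; rewrite lt0r;
  move: tr0; rewrite trE => /psumr_eq0P -> //; rewrite eqxx.
by rewrite mxE.
Qed.

(** Over the complex numbers [A] is Hermitian, so it is unitarily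
    diagonalizable with real eigenvalues.  Each of them is an eigenvalue of [A]
    over the reals as well, which is where positivity can be tested. *)
Lemma real_spectral_pos d (A : 'M[R]_d) : posdefmx A ->
  exists2 P : 'M[R[i]]_d, P \is unitarymx
  & exists2 e : 'rV[R]_d, forall i, 0 < e ord0 i
  & toC A = map_mx (@conjc R) P^T *m diag_mx (toC e) *m P.
Proof.
move=> [Asym Apos].
have AC_herm : toC A \is hermsymmx.
  apply: realsym_hermsym.
    by apply/is_hermitianmxP; rewrite expr0 scale1r;
    apply/matrixP => i j; rewrite !mxE /= -[in LHS]Asym mxE.
  by apply/mxOverP => i j; rewrite mxE complex_real.
have := hermitian_spectral_diag_real AC_herm.
have /hermitian_normalmx/orthomx_spectralP := AC_herm.
set P := spectralmx _; set D := spectral_diag _ => AE Dreal.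
have Pu : P \is unitarymx by exact: spectral_unitarymx.
exists P => //.
have DE : D = toC (map_mx (@complex.Re R) D).
  apply/matrixP => i j; rewrite !mxE RRe_real //.
  by move/mxOverP : Dreal.
exists (map_mx (@complex.Re R) D); last first.
  rewrite -DE [LHS]AE; congr (_ *m _ *m _); rewrite invmx_unitary //.
move=> i.
set r := map_mx _ _ _ _.
have PA : P *m toC A = diag_mx (toC (map_mx (@complex.Re R) D)) *m P.
  by rewrite -DE [in LHS]AE !mulmxA mulmxV ?unitarymx_unit// mul1mx.
have rowE : row i P *m toC A = (map_mx (@complex.Re R) D ord0 i)%:C%C *: row i P.
  by rewrite -row_mul PA; apply/rowP => j; rewrite mul_diag_mx !mxE.
have : eigenvalue A (map_mx (@complex.Re R) D ord0 i).
  rewrite -(eigenvalue_map (real_complex R)); apply/eigenvalueP.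
  exists (row i P) => //.
  apply/eqP => row0; have : row i 1%:M = 0 :> 'rV[R[i]]_d.
    by rewrite -(mulmxV (unitarymx_unit Pu)) row_mul row0 mul0mx.
  by move/rowP/(_ i); rewrite !mxE eqxx => /eqP; rewrite oner_eq0.
move/eigenvalueP => [v vA v0].
have := Apos v^T; rewrite trmx_eq0 => /(_ v0).
rewrite /vdot trmxK -[A]trmxK -trmx_mul Asym vA linearZ -scalemxAr mxE.
rewrite pmulr_lgt0 // mxE lt0r sumr_ge0 ?andbT; last first.
  by move=> k _; rewrite mxE -expr2 sqr_ge0.
rewrite psumr_eq0; last by move=> k _; rewrite mxE -expr2 sqr_ge0.
apply: contra v0 => /allP v0; apply/eqP/rowP => k.
have := v0 k (mem_index_enum _); rewrite !mxE mulf_eq0 orbb.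
by move/eqP.
Qed.

Lemma Re_sum (I : finType) (F : I -> R[i]) :
  complex.Re (\sum_i F i) = \sum_i complex.Re (F i).
Proof. by apply: (big_morph (@complex.Re R)) => // -[a b] []. Qed.

Lemma Im_sum (I : finType) (F : I -> R[i]) :
  complex.Im (\sum_i F i) = \sum_i complex.Im (F i).
Proof. by apply: (big_morph (@complex.Im R)) => // -[a b] []. Qed.

Lemma map_Re_mul d (S T : 'M[R[i]]_d) :
  map_mx (@complex.Re R) (S *m T) =
  map_mx (@complex.Re R) S *m map_mx (@complex.Re R) T
  - map_mx (@complex.Im R) S *m map_mx (@complex.Im R) T.
Proof.
apply/matrixP => i j; rewrite !mxE -sumrB.
rewrite Re_sum; apply: eq_bigr => k _.
by rewrite !mxE; case: (S i k) (T k j) => [a b] [a' b'].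
Qed.

Lemma map_Im_mul d (S T : 'M[R[i]]_d) :
  map_mx (@complex.Im R) (S *m T) =
  map_mx (@complex.Re R) S *m map_mx (@complex.Im R) T
  + map_mx (@complex.Im R) S *m map_mx (@complex.Re R) T.
Proof.
apply/matrixP => i j; rewrite !mxE -big_split /=.
rewrite Im_sum; apply: eq_bigr => k _.
by rewrite !mxE; case: (S i k) (T k j) => [a b] [a' b'].
Qed.

Lemma Re_quadratic_form d (S : 'M[R[i]]_d) (v : 'cV[R]_d) :
  complex.Re (((toC v)^T *m (S *m toC v)) ord0 ord0)
  = vdot v (map_mx (@complex.Re R) S *m v).
Proof.
have ReM (a : R) (z : R[i]) : complex.Re (a%:C%C * z) = a * complex.Re z.
  by case: z => x y /=; rewrite mul0r subr0.
rewrite /vdot !mxE Re_sum.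
apply: eq_bigr => k _; rewrite !mxE ReM; congr (_ * _).
rewrite Re_sum.
by apply: eq_bigr => l _; rewrite !mxE mulrC ReM mulrC.
Qed.

(** The spectral theorem yields a Hermitian square root [X + i Y].  Its real
    part is positive definite, its imaginary part is skew, and the imaginary
    part of the equation for the square reads [X Y + Y X = 0]; so [Y] vanishes
    and the root is real. *)
Lemma posdefmx_sqrt_exists d (A : 'M[R]_d) : posdefmx A ->
  exists S : 'M[R]_d, posdefmx S /\ S *m S = A.
Proof.
move=> Apd; have [P Pu [e epos AE]] := real_spectral_pos Apd.
pose E := \row_i Num.sqrt (e ord0 i).
pose S := map_mx (@conjc R) P^T *m diag_mx (toC E) *m P.
have Pinv : P *m map_mx (@conjc R) P^T = 1%:M by exact/unitarymxP.
have SS : S *m S = toC A.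
  rewrite /S !mulmxA -[_ *m P *m _]mulmxA Pinv mulmx1 AE; congr (_ *m _).
  rewrite -mulmxA; congr (_ *m _); apply/matrixP => i j.
  rewrite mul_diag_mx !mxE; case: eqVneq => [->|_]; rewrite ?mulr0 ?mulr1n//.
  by rewrite -rmorphM -expr2 sqr_sqrtr // ltW.
have Sherm : map_mx (@conjc R) S^T = S.
  rewrite /S !trmx_mul !map_mxM /= tr_diag_mx mulmxA.
  congr (_ *m _ *m _); apply/matrixP => i j; rewrite !mxE ?conjcK//.
  by case: (i == j); rewrite /= oppr0.
have SE i j : S i j = (S j i)^*%C by rewrite -[in LHS]Sherm mxE mxE.
pose X := map_mx (@complex.Re R) S; pose Y := map_mx (@complex.Im R) S.
have XE i j : X i j = complex.Re (S i j) by rewrite [LHS]mxE.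
have YE i j : Y i j = complex.Im (S i j) by rewrite [LHS]mxE.
have Xsym : X^T = X.
  by apply/matrixP => i j; rewrite [LHS]mxE !XE SE; case: (S i j).
have Yskew : Y^T = - Y.
  by apply/matrixP => i j; rewrite [LHS]mxE [RHS]mxE !YE SE; case: (S i j).
have Xpos v : v != 0 -> 0 < vdot v (X *m v).
  move=> v0; pose w := P *m toC v.
  have w0 : w != 0.
    apply: contra v0 => /eqP w0; rewrite -(map_mx_eq0 (real_complex R)).
    by rewrite -(mulKmx (unitarymx_unit Pu) (toC v)) -/w w0 mulmx0.
  have quadE : ((toC v)^T *m (S *m toC v)) ord0 ord0 =
      \sum_i (Num.sqrt (e ord0 i))%:C%C * `|w i ord0| ^+ 2.
    have -> : (toC v)^T *m (S *m toC v) =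
        map_mx (@conjc R) w^T *m (diag_mx (toC E) *m w).
      have -> : map_mx (@conjc R) w^T = (toC v)^T *m map_mx (@conjc R) P^T.
        rewrite trmx_mul map_mxM; congr (_ *m _).
        by apply/matrixP => i j; rewrite !mxE /= oppr0.
      by rewrite /S -!mulmxA.
    clearbody w; rewrite mul_diag_mx mxE; apply: eq_bigr => k _.
    by rewrite !mxE sqr_normc mulrCA [_^*%C * _]mulrC.
  rewrite -Re_quadratic_form quadE.
  suff : (0 < \sum_i (Num.sqrt (e ord0 i))%:C%C * `|w i ord0| ^+ 2).
    by rewrite ltcE => /andP[].
  have ge0 i : true -> 0 <= (Num.sqrt (e ord0 i))%:C%C * `|w i ord0| ^+ 2.
    by move=> _; rewrite mulr_ge0 ?exprn_ge0// ler0c sqrtr_ge0.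
  rewrite lt0r sumr_ge0 // andbT psumr_eq0 //.
  apply: contra w0 => /allP w0; apply/eqP/colP => k.
  have := w0 k (mem_index_enum _); rewrite mulf_eq0 /= expf_eq0 normr_eq0 /=.
  move=> /orP[|/eqP->]; last by rewrite mxE.
  by rewrite eq_complex /= eqxx andbT sqrtr_eq0 leNgt epos.
have XY0 : X *m Y + Y *m X = 0.
  by rewrite -map_Im_mul SS; apply/matrixP => i j; rewrite !mxE.
have Xpd : posdefmx X by split.
have Y0 := anticommuting_skew_eq0 Xpd Yskew XY0.
exists X; split => //.
have := map_Re_mul S S; rewrite SS -/X -/Y Y0 mulmx0 subr0 => <-.
by apply/matrixP => i j; rewrite !mxE.
Qed.
Lemma sqrtmxP d (A : 'M[R]_d) : posdefmx A ->
  posdefmx (sqrtmx A) /\ sqrtmx A *m sqrtmx A = A.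
Proof.
move=> /posdefmx_sqrt_exists[S AS].
exact: (xgetPex 0 (ex_intro [set S | posdefmx S /\ S *m S = A] S AS)).
Qed.
End SquareRoot.

(** * One Broyden update in the Frobenius norm *)

Section Updates.
Context {R : realType} {d : nat}.
Implicit Types (A B E : 'M[R]_d) (s y : 'cV[R]_d).
Local Notation I := (1%:M : 'M[R]_d).

Lemma mulmx_outer (u v w : 'cV[R]_d) : u *m v^T *m w = mdot v w *: u.
Proof. by rewrite -mulmxA [v^T *m w]mx11_scalar -vdotE mul_mx_scalar. Qed.

(** Expanded in this way, the update differs from [B] by rank-one matrices in
    [y] and [B *m s] only, whose inner products are products of inner products
    of vectors. *)
Lemma dfp_updateE B s y : B^T = B ->
  dfp_update B s y =
  B - (mdot s y)^-1 *: (y *m (B *m s)^T + B *m s *m y^T)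
  + ((mdot s y)^-1 ^+ 2 * mdot s (B *m s) + (mdot s y)^-1) *: (y *m y^T).
Proof.
move=> Bsym; rewrite /dfp_update !vdotE (mdotC y s); set c := _^-1.
set b := B *m s.
have sB : s^T *m B = b^T by rewrite /b trmx_mul Bsym.
rewrite mulmxBl mul1mx -scalemxAl -[y *m s^T *m B]mulmxA sB.
rewrite mulmxBr mulmx1 -scalemxAr mulmxBl -scalemxAl !mulmxA -/b.
rewrite mulmx_outer -scalemxAl (mdotC b s).
by apply/matrixP => i j; rewrite !mxE !big_ord1; ring.
Qed.

Lemma bfgs_updateE B s y : B^T = B ->
  bfgs_update B s y =
  B - (mdot s (B *m s))^-1 *: (B *m s *m (B *m s)^T) + (mdot s y)^-1 *: (y *m y^T).
Proof. by move=> Bsym; rewrite /bfgs_update !vdotE trmx_mul Bsym !mulmxA. Qed.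

Lemma broyden_update_sym phi B s y : B^T = B ->
  (broyden_update phi B s y)^T = broyden_update phi B s y.
Proof.
move=> Bsym; rewrite /broyden_update dfp_updateE // bfgs_updateE //.
set b := B *m s; clearbody b.
apply/matrixP => i j; rewrite !mxE !big_ord1 !mxE.
have -> : B j i = B i j by rewrite -[in LHS]Bsym mxE.
ring.
Qed.

Lemma mdot_mulE (B : 'M[R]_d) x y : B^T = B -> mdot x (B *m y) = mdot (B *m x) y.
Proof. by move=> Bsym; rewrite mdot_adj Bsym. Qed.

(** For [y = s] the update compresses [E = B - I] to the orthogonal complement
    of [s].  With [u = s / |s|] the squared norm drops by
    [2 |E u|^2 - (u . E u)^2], which is at least [|E u|^2]. *)
Lemma dfp_update_exact B s : B^T = B -> s != 0 ->
  mdot (dfp_update B s s - I) (dfp_update B s s - I)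
  <= mdot (B - I) (B - I) - mdot ((B - I) *m s) ((B - I) *m s) / mdot s s.
Proof.
move=> Bsym s0; have n0 := mdot_gt0 s0.
pose E := B - I; pose e := E *m s.
have Esym : E^T = E by rewrite /E linearB /= Bsym trmx1.
have -> : dfp_update B s s - I
  = E - (mdot s s)^-1 *: (s *m e^T + e *m s^T)
    + ((mdot s s)^-1 ^+ 2 * mdot s e) *: (s *m s^T).
  rewrite dfp_updateE //.
  have -> : B *m s = e + s by rewrite /e /E mulmxBl mul1mx subrK.
  have -> : B = E + I by rewrite /E subrK.
  rewrite mdotDr; clearbody e; clearbody E.
  apply/matrixP => i j; rewrite !mxE !big_ord1 !mxE.
  by field; rewrite gt_eqF.
rewrite -/E -/e; have eE : E *m s = e by [].
clearbody e; clearbody E.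
have se : mdot s e ^+ 2 <= mdot s s * mdot e e by exact: mdot_CauchySchwarz.
rewrite !(mdotDl, mdotDr, mdotNl, mdotNr, mdotZl, mdotZr) !mdot_outer.
rewrite !(mdotC (_ *m _) E) !mdot_outerr eE (mdot_mulE _ _ Esym) eE.
move: se n0; rewrite (mdotC e s).
set n := mdot s s; set a := mdot s e; set q := mdot e e; set w := mdot E E.
move=> se n0.
have h : a ^+ 2 / n ^+ 2 <= q / n.
  rewrite ler_pdivrMr ?exprn_gt0 //; have -> // : q / n * n ^+ 2 = n * q.
  by field; rewrite gt_eqF.
apply: (@le_trans _ _ (w - 2 * (q / n) + a ^+ 2 / n ^+ 2)); last lra.
rewrite le_eqVlt; apply/orP; left; apply/eqP; field.
by rewrite gt_eqF.
Qed.

(** For [y = s], let [w] be the normalization of [B^(1/2) s].  The squared norm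
    drops by [(w . E w)^2 + 2 (|E w|^2 - (w . E w)^2)], which is at least
    [|E w|^2 = (E s . B E s) / (s . B s)]; the bounds on [B] compare this with
    [|E s|^2 / |s|^2].  Cauchy-Schwarz for the inner product of [B] is used in
    place of the square root. *)
Lemma bfgs_update_exact B s (l u : R) : B^T = B -> s != 0 -> 0 < l -> 0 < u ->
  (forall v : 'cV[R]_d, l * mdot v v <= mdot v (B *m v)) ->
  mdot s (B *m s) <= u * mdot s s ->
  mdot (bfgs_update B s s - I) (bfgs_update B s s - I)
  <= mdot (B - I) (B - I) - l / u * (mdot ((B - I) *m s) ((B - I) *m s) / mdot s s).
Proof.
move=> Bsym s0 l0 u0 Bl Bu; have n0 := mdot_gt0 s0.
have a0 : 0 < mdot s (B *m s) by apply: lt_le_trans (Bl s); rewrite mulr_gt0.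
rewrite bfgs_updateE //; set b := B *m s.
pose e := b - s.
have eE : (B - I) *m s = e by rewrite mulmxBl mul1mx.
have CSB : mdot b b ^+ 2 <= mdot s b * mdot b (B *m b).
  (* this [t] minimizes the form [B] on the line [b - t *: s] *)
  pose t := mdot b b / mdot s b.
  have := Bl (b - t *: s); have : 0 <= l * mdot (b - t *: s) (b - t *: s).
    by rewrite mulr_ge0 ?mdot_ge0 // ltW.
  move=> /le_trans h /h; rewrite mulmxBr -scalemxAr -/b.
  rewrite !(mdotDl, mdotDr, mdotNl, mdotNr, mdotZl, mdotZr).
  rewrite (mdot_mulE s b Bsym) -/b.
  move: a0; rewrite -/b /t.
  set a := mdot s b; set a2 := mdot b b; set a3 := mdot b _ => a0.
  move=> h'; have {h'} : 0 <= a3 - a2 ^+ 2 / a.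
    apply: le_trans h' _; rewrite le_eqVlt; apply/orP; left; apply/eqP.
    by field; rewrite gt_eqF.
  by rewrite subr_ge0 ler_pdivrMr // mulrC.
have De := Bl e; rewrite eE.
have -> : B - (mdot s b)^-1 *: (b *m b^T) + (mdot s s)^-1 *: (s *m s^T) - I
   = (B - I) - (mdot s b)^-1 *: (b *m b^T) + (mdot s s)^-1 *: (s *m s^T).
  by rewrite -!addrA; congr (_ + _); rewrite [in RHS]addrC -!addrA.
have Esym : (B - I)^T = B - I by rewrite linearB /= Bsym trmx1.
have Eb : (B - I) *m b = B *m b - b by rewrite mulmxBl mul1mx.
have eBe : mdot e (B *m e) = mdot b (B *m b) - 2 * mdot b b + mdot s b.
  rewrite /e mulmxBr -/b !(mdotDl, mdotDr, mdotNl, mdotNr).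
  by rewrite (mdot_mulE s b Bsym) -/b; ring.
move: De; rewrite eBe.
have ee : mdot e e = mdot b b - 2 * mdot s b + mdot s s.
  by rewrite /e !(mdotDl, mdotDr, mdotNl, mdotNr) (mdotC b s); ring.
have se : mdot s e = mdot s b - mdot s s by rewrite /e mdotDr mdotNr.
clearbody e; move: eE Eb Esym; set E := B - I; clearbody E => eE Eb Esym.
rewrite !(mdotDl, mdotDr, mdotNl, mdotNr, mdotZl, mdotZr) !mdot_outer.
rewrite !(mdotC (_ *m _) E) !mdot_outerr eE Eb mdotDr mdotNr se ee (mdotC b s).
move: CSB a0 Bu n0 (mdot_ge0 e); rewrite ee -/b.
set n := mdot s s; set a := mdot s b; set a2 := mdot b b; set w := mdot E E.
set a3 := mdot b (B *m b) => CSB a0 Bu n0 ee0 De.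
set p := a3 - 2 * a2 + a in De *.
have lee0 : 0 <= l * (a2 - 2 * a + n) by rewrite mulr_ge0 // ltW.
have h1 : l / u * ((a2 - 2 * a + n) / n) <= p / a.
  rewrite ler_pdivlMr //.
  have -> : l / u * ((a2 - 2 * a + n) / n) * a = l * (a2 - 2 * a + n) * a / (u * n).
    by field; rewrite !gt_eqF.
  by rewrite ler_pdivrMr ?mulr_gt0 // ler_pM // ltW.
have h2 : (a2 / a) ^+ 2 <= a3 / a.
  rewrite expr_div_n ler_pdivrMr ?exprn_gt0 //.
  have -> // : a3 / a * a ^+ 2 = a * a3 by field; rewrite gt_eqF.
apply: (@le_trans _ _ (w - (p / a) + (a2 / a) ^+ 2 - a3 / a)); last lra.
rewrite /p le_eqVlt; apply/orP; left; apply/eqP; field.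
by rewrite !gt_eqF.
Qed.

Lemma secant_curvature s y (tau : R) : mnorm (y - s) <= tau * mnorm s ->
  `|mdot s y - mdot s s| <= tau * mdot s s.
Proof.
move=> ys; rewrite -mdotNr -mdotDr (le_trans (mdot_le_norm _ _)) //.
by rewrite -mnorm_sqr expr2 mulrCA ler_wpM2l ?mnorm_ge0.
Qed.

(** All denominators in the updates are [s . y] or [s . s]; a secant vector [y]
    close to [s] keeps them comparable. *)
Lemma secant_scaling s y (tau : R) : s != 0 -> 0 <= tau < 1 ->
  mnorm (y - s) <= tau * mnorm s ->
  [/\ 0 < mdot s y, (mdot s y)^-1 * mdot s s <= (1 - tau)^-1
    & `|(mdot s y)^-1 - (mdot s s)^-1| * mdot s s <= tau / (1 - tau)].
Proof.
move=> s0 /andP[tau0 tau1] ys; have n0 := mdot_gt0 s0.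
have := secant_curvature ys; rewrite ler_norml => /andP[h1 h2].
have n1 : (1 - tau) * mdot s s <= mdot s y by lra.
have p0 : 0 < mdot s y by apply: lt_le_trans n1; rewrite mulr_gt0 ?subr_gt0.
have le1 : (mdot s y)^-1 * mdot s s <= (1 - tau)^-1.
  by rewrite mulrC ler_pdivrMr // ler_pdivlMl ?subr_gt0.
split=> //.
have -> : (mdot s y)^-1 - (mdot s s)^-1
    = (mdot s s - mdot s y) * ((mdot s y)^-1 * (mdot s s)^-1).
  by field; rewrite !gt_eqF.
rewrite normrM (ger0_norm (_ : 0 <= _ * _)); last by rewrite mulr_ge0 ?invr_ge0 ?ltW.
rewrite mulrA mulfVK ?gt_eqF // distrC.
apply: (@le_trans _ _ (tau * mdot s s * (mdot s y)^-1)).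
  by rewrite ler_pM2r ?invr_gt0 // secant_curvature.
by rewrite -mulrA [_ * _^-1]mulrC ler_wpM2l.
Qed.

Lemma outer_perturb s y (tau : R) : s != 0 -> 0 <= tau < 1 ->
  mnorm (y - s) <= tau * mnorm s ->
  mnorm ((mdot s y)^-1 *: (y *m y^T) - (mdot s s)^-1 *: (s *m s^T))
  <= tau * ((3 + tau) / (1 - tau)).
Proof.
move=> s0 tau01 ys; have [p0 le1 le2] := secant_scaling s0 tau01 ys.
have /andP[tau0 tau1] := tau01.
set c := _^-1 in le1 le2 *; set c0 := _^-1 in le2 *.
have -> : c *: (y *m y^T) - c0 *: (s *m s^T) =
    c *: ((y - s) *m y^T) + c *: (s *m (y - s)^T) + (c - c0) *: (s *m s^T).
  by apply/matrixP => i j; rewrite !mxE !big_ord1 !mxE; ring.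
apply: le_trans (mnormD _ _) _; apply: le_trans (lerD (mnormD _ _) (lexx _)) _.
rewrite !mnormZ !mnorm_outer -expr2 mnorm_sqr.
have c_gt0 : 0 < c by rewrite invr_gt0.
rewrite (ger0_norm (ltW c_gt0)).
have yn : mnorm y <= (1 + tau) * mnorm s.
  by rewrite -[y](subrK s) (le_trans (mnormD _ _)) // mulrDl mul1r addrC lerD2l.
have k0 : 0 < (1 - tau)^-1 by rewrite invr_gt0 subr_gt0.
have t1 : c * (mnorm (y - s) * mnorm y) <= tau * (1 + tau) * (1 - tau)^-1.
  apply: (@le_trans _ _ (tau * (1 + tau) * (c * mdot s s))).
    rewrite -mnorm_sqr (mulrCA _ c) ler_pM2l //.
    have -> : tau * (1 + tau) * mnorm s ^+ 2 = tau * mnorm s * ((1 + tau) * mnorm s).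
      by ring.
    by rewrite ler_pM ?mnorm_ge0.
  by rewrite ler_wpM2l // mulr_ge0 // addr_ge0.
have t2 : c * (mnorm s * mnorm (y - s)) <= tau * (1 - tau)^-1.
  apply: (@le_trans _ _ (tau * (c * mdot s s))); last by rewrite ler_wpM2l.
  rewrite -mnorm_sqr (mulrCA _ c) ler_pM2l // expr2 [leRHS]mulrCA.
  by rewrite ler_wpM2l ?mnorm_ge0.
move: t1 t2 le2; set k := _^-1; nra.
Qed.

(** Passing from the pair [(s, s)] to [(s, y)] changes the update by rank-one
    terms in [w = y / (s . y) - s / (s . s)], which is of size [tau / |s|], plus
    the change of the last outer product. *)
Lemma dfp_perturb B s y (tau u : R) : B^T = B -> s != 0 -> 0 <= tau < 1 ->
  mnorm (y - s) <= tau * mnorm s -> 0 <= u -> mnorm (B *m s) <= u * mnorm s ->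
  mnorm (dfp_update B s y - dfp_update B s s)
  <= tau * (u * (4 / (1 - tau) ^+ 2) + (3 + tau) / (1 - tau)).
Proof.
move=> Bsym s0 tau01 ys u0 Bs; have [p0 le1 le2] := secant_scaling s0 tau01 ys.
have op := outer_perturb s0 tau01 ys.
have /andP[tau0 tau1] := tau01; have n0 := mdot_gt0 s0.
rewrite !dfp_updateE //; set b := B *m s in Bs *.
set c := (mdot s y)^-1 in le1 le2 op *; set c0 := (mdot s s)^-1 in le2 op *.
(* [b'] is the component of [B *m s] orthogonal to [s] *)
pose w := c *: y - c0 *: s; pose b' := b - (c0 * mdot s b) *: s.
set D := _ - _ in op.
have c_gt0 : 0 < c by rewrite invr_gt0.
have -> : B - c *: (y *m b^T + b *m y^T) + (c ^+ 2 * mdot s b + c) *: (y *m y^T)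
   - (B - c0 *: (s *m b^T + b *m s^T) + (c0 ^+ 2 * mdot s b + c0) *: (s *m s^T))
   = - (w *m b'^T) - b' *m w^T + mdot s b *: (w *m w^T) + D.
  rewrite /D /b' /w; clearbody b c c0.
  by apply/matrixP => i j; rewrite !mxE !big_ord1 !mxE; ring.
have b'_le : mnorm b' <= mnorm b.
  apply: mnorm_le; rewrite ?mnorm_ge0 // mnorm_sqr /b'.
  rewrite !(mdotDl, mdotDr, mdotNl, mdotNr, mdotZl, mdotZr) (mdotC b s).
  have -> : c0 * mdot s b * (c0 * mdot s b * mdot s s) = c0 * mdot s b ^+ 2.
    by rewrite /c0; field; rewrite gt_eqF.
  have : 0 <= c0 * mdot s b ^+ 2 by rewrite mulr_ge0 ?sqr_ge0 ?invr_ge0 ?ltW.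
  lra.
have k0 : 0 < (1 - tau)^-1 by rewrite invr_gt0 subr_gt0.
have w_le : mnorm w * mnorm s <= 2 * tau / (1 - tau).
  have -> : w = c *: (y - s) + (c - c0) *: s.
    by rewrite /w scalerBr scalerBl addrA subrK.
  apply: le_trans (ler_wpM2r (mnorm_ge0 _) (mnormD _ _)) _.
  rewrite !mnormZ mulrDl -!mulrA -!expr2 !mnorm_sqr (ger0_norm (ltW c_gt0)).
  have : c * (mnorm (y - s) * mnorm s) <= tau * (1 - tau)^-1.
    apply: (@le_trans _ _ (tau * (c * mdot s s))); last by rewrite ler_wpM2l.
    rewrite -mnorm_sqr (mulrCA _ c) ler_pM2l ?invr_gt0 // expr2 mulrA.
    by rewrite ler_wpM2r ?mnorm_ge0.
  move: le2; lra.
have sb : `|mdot s b| <= u * mnorm s ^+ 2.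
  apply: le_trans (mdot_le_norm _ _) _.
  by rewrite expr2 [leRHS]mulrCA ler_wpM2l ?mnorm_ge0.
apply: le_trans (mnormD _ _) _.
rewrite mulrDr lerD //.
apply: le_trans (mnormD _ _) _; apply: le_trans (lerD (mnormB _ _) (lexx _)) _.
rewrite mnormN mnormZ !mnorm_outer.
have t1 : mnorm w * mnorm b' <= u * (2 * tau / (1 - tau)).
  apply: (@le_trans _ _ (mnorm w * (u * mnorm s))).
    by rewrite ler_wpM2l ?mnorm_ge0 // (le_trans b'_le).
  by rewrite [leLHS]mulrCA ler_wpM2l.
have t2 : `|mdot s b| * (mnorm w * mnorm w) <= u * (2 * tau / (1 - tau)) ^+ 2.
  apply: (@le_trans _ _ (u * mnorm s ^+ 2 * (mnorm w * mnorm w))).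
    by rewrite ler_wpM2r ?mulr_ge0 ?mnorm_ge0.
  have -> : u * mnorm s ^+ 2 * (mnorm w * mnorm w) = u * (mnorm w * mnorm s) ^+ 2.
    by ring.
  by rewrite ler_wpM2l // ler_pXn2r ?nnegrE ?mulr_ge0 ?mnorm_ge0 // ltW.
rewrite (mulrC (mnorm b')).
have -> : tau * (u * (4 / (1 - tau) ^+ 2)) =
  u * (2 * tau / (1 - tau)) + u * (2 * tau / (1 - tau)) + u * (2 * tau / (1 - tau)) ^+ 2.
  by field; rewrite subr_eq0 gt_eqF.
by rewrite !lerD.
Qed.

(** A drop [t] of the square of a norm that is at most [D] is a drop of at least
    [t / (2 D)] of the norm.  The drops of successive norms can be summed, also
    when perturbations intervene. *)
Lemma mnorm_decrease (E E' : 'M[R]_d) (t D : R) :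
  0 < D -> mnorm E <= D -> 0 <= t -> t <= mnorm E ^+ 2 ->
  mdot E' E' <= mdot E E - t -> mnorm E' <= mnorm E - t / (2 * D).
Proof.
move=> D0 ED t0 tE E'E; set m := mnorm E in ED tE *.
have m0 : 0 <= m by exact: mnorm_ge0.
have mD : m ^+ 2 <= m * D by rewrite expr2 ler_wpM2l.
have tD : t / (2 * D) <= m / 2.
  rewrite ler_pdivrMr ?mulr_gt0 //; have -> : m / 2 * (2 * D) = m * D by field.
  exact: le_trans mD.
apply: mnorm_le; first lra.
apply: le_trans E'E _; rewrite -mnorm_sqr -/m.
have : 2 * m * (t / (2 * D)) <= t.
  have -> : 2 * m * (t / (2 * D)) = t * m / D by field; rewrite gt_eqF.
  by rewrite ler_pdivrMr // ler_wpM2l.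
have := sqr_ge0 (t / (2 * D)); rewrite sqrrB -mulr_natr; lra.
Qed.

Lemma mdot_nearI B (D : R) : mnorm (B - I) <= D ->
  forall v : 'cV[R]_d, (1 - D) * mdot v v <= mdot v (B *m v) <= (1 + D) * mdot v v.
Proof.
move=> BD v; have -> : B *m v = (B - I) *m v + v by rewrite mulmxBl mul1mx subrK.
have : `|mdot v ((B - I) *m v)| <= D * mdot v v.
  apply: le_trans (mdot_le_norm _ _) _.
  rewrite -mnorm_sqr expr2 [leRHS]mulrCA ler_wpM2l ?mnorm_ge0 //.
  by rewrite (le_trans (mnorm_mulmx _ _)) // ler_wpM2r ?mnorm_ge0.
by rewrite ler_norml mdotDr => /andP[h1 h2]; apply/andP; split; lra.
Qed.

Lemma mnorm_nearI B (D : R) (v : 'cV[R]_d) : mnorm (B - I) <= D ->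
  mnorm (B *m v) <= (1 + D) * mnorm v.
Proof.
move=> BD; have -> : B *m v = v + (B - I) *m v by rewrite mulmxBl mul1mx addrC subrK.
rewrite (le_trans (mnormD _ _)) // mulrDl mul1r lerD2l.
by rewrite (le_trans (mnorm_mulmx _ _)) // ler_wpM2r ?mnorm_ge0.
Qed.

(** The convex combination of the two exact updates has the decrease of the DFP
    update with weight [phi] and that of the BFGS update, smaller by the ratio
    of the bounds on the spectrum of [B], with weight [1 - phi]; the perturbations from
    [y <> s] are added. *)
Lemma broyden_update_contract (phi tau eps delta : R) B s y :
  0 <= phi <= 1 -> B^T = B -> s != 0 -> 0 <= tau <= eps -> eps < 1 ->
  mnorm (y - s) <= tau * mnorm s -> 0 < delta < 1 / 2 ->
  mnorm (B - I) <= 2 * delta ->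
  mnorm (broyden_update phi B s y - I) <=
  mnorm (B - I)
  - (phi + (1 - phi) * ((1 - 2 * delta) / (1 + 2 * delta)))
    * (mdot ((B - I) *m s) ((B - I) *m s) / mdot s s) / (4 * delta)
  + tau * (phi * (2 * delta + 1) * (4 / (1 - eps) ^+ 2) + (3 + eps) / (1 - eps)).
Proof.
move=> /andP[phi0 phi1] Bsym s0 /andP[tau0 taueps] eps1 ys /andP[delta0 delta1] BD.
have n0 := mdot_gt0 s0.
have tau01 : 0 <= tau < 1 by rewrite tau0 (le_lt_trans taueps).
set m := mnorm (B - I) in BD *; set th := _ / mdot s s.
set kap := (1 - 2 * delta) / (1 + 2 * delta).
have kap0 : 0 <= kap by rewrite divr_ge0; lra.
have kap1 : kap <= 1 by rewrite ler_pdivrMr; lra.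
have th0 : 0 <= th by rewrite divr_ge0 ?mdot_ge0.
have thm : th <= m ^+ 2.
  rewrite ler_pdivrMr // -!mnorm_sqr -exprMn.
  by rewrite ler_pXn2r ?nnegrE ?mulr_ge0 ?mnorm_ge0 ?mnorm_mulmx.
have dfp_le : mnorm (dfp_update B s s - I) <= m - th / (4 * delta).
  have -> : 4 * delta = 2 * (2 * delta) by ring.
  by apply: mnorm_decrease => //; rewrite ?mulr_gt0 // dfp_update_exact.
have bfgs_le : mnorm (bfgs_update B s s - I) <= m - kap * th / (4 * delta).
  have -> : 4 * delta = 2 * (2 * delta) by ring.
  apply: mnorm_decrease => //; rewrite ?(mulr_ge0 kap0 th0) ?mulr_gt0 //.
    by apply: le_trans thm; rewrite ler_piMl.
  apply: bfgs_update_exact => //; try lra.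
    by move=> v; have /andP[] := mdot_nearI BD v.
  by have /andP[] := mdot_nearI BD s.
have dfpp : mnorm (dfp_update B s y - dfp_update B s s)
    <= tau * ((2 * delta + 1) * (4 / (1 - tau) ^+ 2) + (3 + tau) / (1 - tau)).
  apply: dfp_perturb => //; first lra.
  by rewrite [2 * delta + 1]addrC mnorm_nearI.
have bfgsp := outer_perturb s0 tau01 ys.
have -> : broyden_update phi B s y - I =
   phi *: (dfp_update B s s - I) + (1 - phi) *: (bfgs_update B s s - I)
   + (phi *: (dfp_update B s y - dfp_update B s s)
   + (1 - phi) *: ((mdot s y)^-1 *: (y *m y^T) - (mdot s s)^-1 *: (s *m s^T))).
  rewrite /broyden_update !bfgs_updateE //.
  set X := dfp_update _ _ _; set Y := dfp_update _ _ _.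
  set c := (mdot s _)^-1; set U := _ *m _; set V := _ *m _; set W := _ *m _.
  apply/matrixP => i j; rewrite !mxE; ring.
apply: le_trans (mnormD _ _) _.
have -> : m - (phi + (1 - phi) * kap) * th / (4 * delta) =
  phi * (m - th / (4 * delta)) + (1 - phi) * (m - kap * th / (4 * delta)) by ring.
apply: lerD.
  apply: le_trans (mnormD _ _) _; rewrite !mnormZ !ger0_norm ?subr_ge0 //.
  by rewrite lerD // ler_wpM2l // subr_ge0.
apply: le_trans (mnormD _ _) _; rewrite !mnormZ !ger0_norm ?subr_ge0 //.
apply: (@le_trans _ _ (tau * (phi * (2 * delta + 1) * (4 / (1 - tau) ^+ 2)
                              + (3 + tau) / (1 - tau)))).
  have := lerD (ler_wpM2l phi0 dfpp) (ler_wpM2l (_ : 0 <= 1 - phi) bfgsp).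
  rewrite subr_ge0 => /(_ phi1); lra.
have eps1' : 0 < 1 - eps by rewrite subr_gt0.
have inv_le : (1 - tau)^-1 <= (1 - eps)^-1.
  by rewrite lef_pV2 ?posrE; lra.
have invt0 : 0 <= (1 - tau)^-1 by rewrite invr_ge0; lra.
rewrite ler_wpM2l // lerD //.
  rewrite ler_wpM2l //; first by rewrite mulr_ge0 //; lra.
  by rewrite ler_wpM2l // -!exprVn ler_pXn2r ?nnegrE // (le_trans invt0).
by rewrite ler_pM //; lra.
Qed.

(** A congruence by [T] maps outer products to outer products, and the scalars
    in the update pair a vector of type [s] with one of type [y], so that [T] and
    its inverse [S] cancel. *)
Lemma broyden_update_congr (phi : R) (T S : 'M[R]_d) B s y :
  T^T = T -> S^T = S -> T *m S = I -> B^T = B ->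
  T *m broyden_update phi B s y *m T
  = broyden_update phi (T *m B *m T) (S *m s) (T *m y).
Proof.
move=> Tsym Ssym TS Bsym.
have ST : S *m T = I by rewrite -[S]Ssym -[T]Tsym -trmx_mul TS trmx1.
have outer (u v : 'cV[R]_d) : T *m (u *m v^T) *m T = (T *m u) *m (T *m v)^T.
  by rewrite trmx_mul Tsym !mulmxA.
have TBTsym : (T *m B *m T)^T = T *m B *m T.
  by rewrite !trmx_mul Tsym Bsym mulmxA.
have dotK (u v : 'cV[R]_d) : mdot (S *m u) (T *m v) = mdot u v.
  by rewrite mdot_adj Tsym mulmxA TS mul1mx.
rewrite /broyden_update !dfp_updateE // !bfgs_updateE //.
have -> : T *m B *m T *m (S *m s) = T *m (B *m s).
  by rewrite -!mulmxA (mulmxA T S) TS mul1mx.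
rewrite !dotK.
by rewrite !(mulmxDr, mulmxDl, mulmxN, mulNmx) -!scalemxAr -!scalemxAl
  !(mulmxDr, mulmxDl, mulmxN, mulNmx) -!scalemxAr -!scalemxAl
  !(mulmxDr, mulmxDl) !outer.
Qed.

Lemma nearI_unitmx (A : 'M[R]_d) (D : R) : mnorm (A - I) <= D -> D < 1 ->
  A \in unitmx.
Proof.
move=> AD D1; rewrite -row_free_unit -kermx_eq0; apply/rowV0P => v.
move=> /sub_kermxP vA; apply: trmx_inj; rewrite trmx0; apply/eqP.
apply: contraT => /mdot_gt0 v0; have /andP[+ _] := mdot_nearI AD v^T.
have -> : mdot v^T (A *m v^T) = 0 by rewrite /mdot trmxK mulmxA vA mul0mx mxtrace0.
by rewrite pmulr_lle0 // leNgt subr_gt0 D1.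
Qed.

End Updates.

(** * Convergence of the preconditioned iteration *)

Section NormalizedIteration.
Context {R : realType} {d : nat}.
(** Here [r], [g] and [B] are the error, the gradient and the matrix after
    preconditioning.  The step equation is required for invertible [B k] only:
    the value of [invmx] at a singular matrix is not compatible with the change
    of coordinates.  That [B k] is invertible is part of what is proved. *)
Context (phi : nat -> R) (r g : nat -> 'cV[R]_d) (B : nat -> 'M[R]_d).
Context (c eps delta rho q : R).
Local Notation I := (1%:M : 'M[R]_d).
Local Notation s k := (r k.+1 - r k).
Local Notation y k := (g k.+1 - g k).
Local Notation kappa := ((1 - 2 * delta) / (1 + 2 * delta)).

Context (phi01 : forall k, 0 <= phi k <= 1).
Context (B0_sym : (B 0%N)^T = B 0%N).
Context (B0_close : mnorm (B 0%N - I) <= delta).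
Context (r_step : forall k, B k \in unitmx ->
  r k.+1 = r k - invmx (B k) *m g k).
Context (B_step : forall k, B k.+1 = broyden_update (phi k) (B k) (s k) (y k)).
Context (s_neq0 : forall k, s k != 0).
Context (c_ge0 : 0 <= c).
Context (r0_close : c * mnorm (r 0%N) <= eps).
Context (g_close : forall k,
  mnorm (g k - r k) <= c * mnorm (r k) / 2 * mnorm (r k)).
Context (y_close : forall k, mnorm (y k - s k)
  <= c * Num.max (mnorm (r k)) (mnorm (r k.+1)) * mnorm (s k)).
Context (eps_bnd : 0 < eps < 1 / 2).
Context (delta_bnd : 0 < delta < 1 / 2).
Context (rho_bnd : 0 < rho < 1).
Context (cond1 : forall k,
  (phi k * (2 * delta + 1) * (4 / (1 - eps) ^+ 2) + (3 + eps) / (1 - eps))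
  * (eps / (1 - rho)) <= delta).
Context (cond2 : eps / 2 + 2 * delta <= (1 - 2 * delta) * rho).
Context (q_gt0 : 0 < q).
Context (q_bnd : forall k, 1 <= q ^+ 2 * (phi k + (1 - phi k) * kappa)).

Let theta k := mnorm ((B k - I) *m s k) / mnorm (s k).

(** Two readings of the step.  From [B r' = (B - I) r - (g - r)] the error
    contracts linearly, because [B] is near the identity and [g] near [r].  From
    [B s = - g] one has [r' = - (g - r) - (B - I) s], so that the error ratio
    is governed by [theta]. *)
Lemma quasi_newton_step k : mnorm (B k - I) <= 2 * delta ->
  c * mnorm (r k) <= eps ->
  mnorm (r k.+1) <= rho * mnorm (r k) /\
  mnorm (r k.+1) <= ((1 + rho) * theta k + c * mnorm (r k) / 2) * mnorm (r k).
Proof.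
move=> Bk rk; have /andP[rho0 rho1] := rho_bnd.
have /andP[delta0 delta1] := delta_bnd.
have Bu : B k \in unitmx by apply: (nearI_unitmx Bk); lra.
have Bs : B k *m s k = - g k.
  by rewrite (r_step Bu) addrAC subrr sub0r mulmxN mulKVmx.
have gk := g_close k; have rk0 := mnorm_ge0 (r k).
have gk' : mnorm (g k - r k) <= eps / 2 * mnorm (r k).
  by apply: le_trans gk _; rewrite ler_wpM2r // ler_pM2r ?invr_gt0.
have lin : mnorm (r k.+1) <= rho * mnorm (r k).
  have Er : r k.+1 = (B k - I) *m r k - (g k - r k) - (B k - I) *m r k.+1.
    apply/eqP; rewrite eq_sym subr_eq eq_sym; apply/eqP.
    rewrite !mulmxBl !mul1mx addrCA subrr addr0.
    rewrite -[r k.+1](subrK (r k)) mulmxDr Bs.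
    by rewrite opprB addrA subrK addrC.
  have h1 : mnorm ((B k - I) *m r k) <= 2 * delta * mnorm (r k).
    by apply: le_trans (mnorm_mulmx _ _) _; rewrite ler_wpM2r.
  have h2 : mnorm ((B k - I) *m r k.+1) <= 2 * delta * mnorm (r k.+1).
    by apply: le_trans (mnorm_mulmx _ _) _; rewrite ler_wpM2r ?mnorm_ge0.
  have h3 : mnorm (r k.+1) <= 2 * delta * mnorm (r k) + eps / 2 * mnorm (r k)
      + 2 * delta * mnorm (r k.+1).
    rewrite {1}Er (le_trans (mnormB _ _)) // lerD // (le_trans (mnormB _ _)) //.
    by rewrite lerD.
  have h4 := ler_wpM2r rk0 cond2.
  rewrite -(ler_pM2l (_ : 0 < 1 - 2 * delta)); lra.
split=> //.
have -> : r k.+1 = - (g k - r k) - (B k - I) *m s k.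
  by rewrite mulmxBl mul1mx Bs opprB -addrA -opprD; apply/colP => i; rewrite !mxE; ring.
rewrite (le_trans (mnormB _ _)) // mnormN addrC mulrDl lerD //.
have sk := mnorm_gt0 (s_neq0 k).
have -> : mnorm ((B k - I) *m s k) = theta k * mnorm (s k).
  by rewrite /theta mulfVK // gt_eqF.
rewrite [(1 + rho) * _]mulrC -[leRHS]mulrA ler_wpM2l ?divr_ge0 ?mnorm_ge0 //.
rewrite (le_trans (mnormB _ _)) //; lra.
Qed.

(** The distance to the identity may grow at step [k] by a multiple of
    [c |r k| <= eps rho^k], so by at most [delta (1 - rho) rho^k], while it
    decreases by a multiple of [theta k ^ 2]; the bound is the telescoped
    balance.  It stays below [2 delta], which is what the next step requires. *)
Lemma iteration_invariant k :
  [/\ (B k)^T = B k,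
      mnorm (B k - I) + (\sum_(i < k) theta i ^+ 2) / (4 * delta * q ^+ 2)
        <= delta + delta * (1 - rho ^+ k)
    & mnorm (r k) <= rho ^+ k * mnorm (r 0%N)].
Proof.
have /andP[rho0 rho1] := rho_bnd.
have /andP[delta0 delta1] := delta_bnd.
have /andP[eps0 eps1] := eps_bnd.
have q2 : 0 < q ^+ 2 by rewrite exprn_gt0.
elim: k => [|k [Bsym Bk rk]].
  by split; rewrite ?expr0 ?mul1r // big_ord0 mul0r subrr mulr0 !addr0.
have S0 : 0 <= (\sum_(i < k) theta i ^+ 2) / (4 * delta * q ^+ 2).
  by rewrite divr_ge0 ?sumr_ge0 // => [i _|]; rewrite ?sqr_ge0 // !mulr_ge0 // ltW.
have rhok : 0 < rho ^+ k by rewrite exprn_gt0.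
have rhok1 : rho ^+ k <= 1 by rewrite exprn_ile1 // ltW.
have drk : 0 < delta * rho ^+ k by rewrite mulr_gt0.
have Bk2 : mnorm (B k - I) <= 2 * delta by lra.
have crk : c * mnorm (r k) <= rho ^+ k * eps.
  by apply: le_trans (ler_wpM2l c_ge0 rk) _; rewrite mulrCA ler_wpM2l // ltW.
have crk1 : c * mnorm (r k) <= eps by apply: le_trans crk _; rewrite ler_piMl // ltW.
have [lin _] := quasi_newton_step Bk2 crk1.
split.
- by rewrite B_step broyden_update_sym.
- have rk_max : Num.max (mnorm (r k)) (mnorm (r k.+1)) = mnorm (r k).
    apply: max_idPl; apply: le_trans lin _.
    by rewrite ler_piMl ?mnorm_ge0 // ltW.
  have := y_close k; rewrite rk_max => yk.
  have tau0 : 0 <= c * mnorm (r k) <= eps by rewrite crk1 mulr_ge0 ?mnorm_ge0.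
  have eps_lt1 : eps < 1 by lra.
  have := broyden_update_contract (phi01 k) Bsym (s_neq0 k) tau0 eps_lt1 yk delta_bnd Bk2.
  rewrite -B_step; set W := (phi k * _ * _ + _) => contr.
  have W0 : 0 <= W.
    have /andP[? ?] := phi01 k.
    apply: addr_ge0; last by rewrite divr_ge0; lra.
    by rewrite mulr_ge0 ?divr_ge0 ?sqr_ge0 // mulr_ge0 //; lra.
  have thE : theta k ^+ 2 = mdot ((B k - I) *m s k) ((B k - I) *m s k) / mdot (s k) (s k).
    by rewrite /theta expr_div_n !mnorm_sqr.
  rewrite -thE in contr.
  have Wtau : c * mnorm (r k) * W <= delta * (rho ^+ k - rho ^+ k.+1).
    apply: le_trans (ler_wpM2r W0 crk) _.
    have := cond1 k; rewrite -/W mulrA ler_pdivrMr ?subr_gt0 // => cW.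
    have := ler_wpM2l (ltW rhok) cW; rewrite exprS; lra.
  have dec : theta k ^+ 2 / (4 * delta * q ^+ 2)
      <= (phi k + (1 - phi k) * kappa) * theta k ^+ 2 / (4 * delta).
    rewrite ler_pdivrMr; last by rewrite !mulr_gt0.
    set w := (phi k + _).
    have -> : w * theta k ^+ 2 / (4 * delta) * (4 * delta * q ^+ 2)
       = (q ^+ 2 * w) * theta k ^+ 2 by field; rewrite gt_eqF.
    by rewrite ler_peMl ?sqr_ge0 // q_bnd.
  rewrite big_ord_recr /= mulrDl; lra.
- apply: le_trans lin _; rewrite exprS -mulrA ler_wpM2l // ltW //.
Qed.

Lemma iteration_linear_rate k : mnorm (r k) <= rho ^+ k * mnorm (r 0%N).
Proof. by have [] := iteration_invariant k. Qed.

(** The error is a product of ratios [a i], and the arithmetic-geometric mean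
    inequality bounds it by the mean of the [a i] to the power [k].  The
    bound on the sum of the [theta i ^ 2] leaves only [sqrt k] for the sum of
    the [theta i], which is why the mean tends to 0. *)
Lemma iteration_superlinear_rate k : (0 < k)%N ->
  mnorm (r k) <= (((1 + rho) * (2 * Num.sqrt 2 * delta * q * Num.sqrt k%:R)
                   + eps / (2 * (1 - rho))) / k%:R) ^+ k * mnorm (r 0%N).
Proof.
move=> k_gt0; have /andP[rho0 rho1] := rho_bnd.
have /andP[delta0 delta1] := delta_bnd.
have /andP[eps0 eps1] := eps_bnd.
have theta0 i : 0 <= theta i by rewrite divr_ge0 ?mnorm_ge0.
pose a i := (1 + rho) * theta i + eps / 2 * rho ^+ i.
have a0 i : 0 <= a i.
  apply: addr_ge0; first by rewrite mulr_ge0 //; lra.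
  by apply: mulr_ge0; [lra | rewrite exprn_ge0 // ltW].
have near n : mnorm (B n - I) <= 2 * delta /\
    (\sum_(i < n) theta i ^+ 2) <= 8 * delta ^+ 2 * q ^+ 2.
  have [_ h _] := iteration_invariant n.
  have S0 : 0 <= \sum_(i < n) theta i ^+ 2 by rewrite sumr_ge0 // => i _; rewrite sqr_ge0.
  have D0 : 0 < 4 * delta * q ^+ 2 by rewrite !mulr_gt0 // exprn_gt0.
  have := exprn_gt0 n rho0; move=> /(mulr_gt0 delta0) hr.
  have S0' : 0 <= (\sum_(i < n) theta i ^+ 2) / (4 * delta * q ^+ 2).
    by rewrite divr_ge0 // ltW.
  have B0' := mnorm_ge0 (B n - I).
  split; first lra.
  have -> : 8 * delta ^+ 2 * q ^+ 2 = 2 * delta * (4 * delta * q ^+ 2) by ring.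
  rewrite -ler_pdivrMr //; lra.
have step i : mnorm (r i.+1) <= a i * mnorm (r i).
  have [Bi _] := near i; have ri := iteration_linear_rate i.
  have cri : c * mnorm (r i) <= rho ^+ i * eps.
    by apply: le_trans (ler_wpM2l c_ge0 ri) _; rewrite mulrCA ler_wpM2l // exprn_ge0 // ltW.
  have rhoi1 : rho ^+ i <= 1 by rewrite exprn_ile1 // ltW.
  have cri1 : c * mnorm (r i) <= eps by apply: le_trans cri _; rewrite ler_piMl // ltW.
  have [_ h] := quasi_newton_step Bi cri1.
  apply: le_trans h _; rewrite ler_wpM2r ?mnorm_ge0 // /a lerD2l; lra.
have prod n : mnorm (r n) <= \prod_(i < n) a i * mnorm (r 0%N).
  elim: n => [|n IH]; first by rewrite big_ord0 mul1r.
  rewrite big_ord_recr /= mulrAC mulrC; apply: le_trans (step n) _.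
  by rewrite ler_wpM2l.
apply: le_trans (prod k) _; rewrite ler_wpM2r ?mnorm_ge0 //.
have kR : 0 < k%:R :> R by rewrite ltr0n.
have agm : \prod_(i < k) a i <= ((\sum_(i < k) a i) / k%:R) ^+ k.
  have [+ _] := leif_AGM (A := predT) (E := fun i : 'I_k => a i) (fun i _ => a0 i).
  by rewrite card_ord.
apply: le_trans agm _.
have sum_le : \sum_(i < k) a i <= (1 + rho) * (2 * Num.sqrt 2 * delta * q * Num.sqrt k%:R)
                   + eps / (2 * (1 - rho)).
  rewrite big_split /= -!mulr_sumr lerD //.
    rewrite ler_wpM2l //; first lra.
    pose C := 2 * Num.sqrt 2 * delta * q.
    have s2 : 0 < Num.sqrt 2 :> R by rewrite sqrtr_gt0.
    have C0 : 0 < C by rewrite !mulr_gt0.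
    have C2 : C ^+ 2 = 8 * delta ^+ 2 * q ^+ 2.
      by rewrite /C !exprMn sqr_sqrtr //; ring.
    have [_] := near k; rewrite -C2 -/C => sq_le.
    pose sk : R := Num.sqrt k%:R.
    have sk0 : 0 < sk by rewrite sqrtr_gt0.
    have skk : sk ^+ 2 = k%:R by rewrite sqr_sqrtr // ltW.
    (* 2 t <= t^2 / w + w for the weight w = C / sqrt k *)
    have young i : theta i <= (theta i ^+ 2 * (sk / C) + C / sk) / 2.
      have := mulr_ge0 (ltW (divr_gt0 sk0 C0)) (sqr_ge0 (theta i - C / sk)).
      rewrite sqrrB.
      have -> : sk / C * (theta i ^+ 2 - theta i * (C / sk) *+ 2 + (C / sk) ^+ 2)
        = theta i ^+ 2 * (sk / C) - 2 * theta i + C / sk.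
        by field; rewrite !gt_eqF.
      lra.
    have : \sum_(i < k) theta i
        <= \sum_(i < k) (theta i ^+ 2 * (sk / C) + C / sk) / 2.
      by apply: ler_sum => i _; exact: young.
    move=> /le_trans; apply.
    rewrite -mulr_suml big_split /= -mulr_suml sumr_const card_ord -[_ *+ k]mulr_natr -/sk -skk.
    have -> : C / sk * sk ^+ 2 = C * sk by field; rewrite gt_eqF.
    have := ler_wpM2r (ltW (divr_gt0 sk0 C0)) sq_le.
    have -> : C ^+ 2 * (sk / C) = C * sk by field; rewrite gt_eqF.
    lra.
  have geo : (\sum_(i < k) rho ^+ i) <= (1 - rho)^-1.
    have geoE n : (1 - rho) * (\sum_(i < n) rho ^+ i) = 1 - rho ^+ n.
      elim: n => [|n IH]; first by rewrite big_ord0 mulr0 expr0 subrr.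
      by rewrite big_ord_recr /= mulrDr IH exprS; ring.
    rewrite -[leRHS]mul1r ler_pdivlMr ?subr_gt0 // mulrC geoE.
    by rewrite gerBl exprn_ge0 // ltW.
  have -> : eps / (2 * (1 - rho)) = eps / 2 * (1 - rho)^-1.
    by field; rewrite subr_eq0 gt_eqF.
  by rewrite ler_wpM2l //; lra.
rewrite ler_pXn2r ?nnegrE ?ler_pM2r ?invr_gt0 //.
  by rewrite divr_ge0 ?sumr_ge0 ?ltW.
by rewrite divr_ge0 ?(le_trans _ sum_le) ?sumr_ge0 ?ltW.
Qed.

End NormalizedIteration.

(** * Differentiation along lines and the quadratic model at the minimizer *)

Section LineCalculus.
Context {R : realType} {d : nat}.
Implicit Types (x v u z : 'cV[R]_d).

(** The mean value theorem for [F] minus a primitive of the quadratic bound.  It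
    plays the role of integrating the derivative, which need not be continuous. *)
Lemma increment_le (F dF : R -> R) (a b c : R) :
  (forall t : R, is_derive t 1 F (dF t)) ->
  (forall t : R, 0 <= t <= 1 -> dF t <= a + b * t + c * t ^+ 2) ->
  F 1 - F 0 <= a + b / 2 + c / 3.
Proof.
move=> Fder dF_le.
pose G t := F t - (a * t + b / 2 * t ^+ 2 + c / 3 * t ^+ 3).
have Gder (t : R) : is_derive t 1 G (dF t - (a + b * t + c * t ^+ 2)).
  have := Fder t => ?.
  apply: is_derive_eq.
  by rewrite /GRing.scale /=; field.
have Gcont : {within `[0, 1], continuous G}.
  by apply: derivable_within_continuous => t _; exact: ex_derive.
have [t] := MVT_segment ler01 (fun t _ => Gder t) Gcont.
rewrite in_itv /= => /dF_le dFt.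
rewrite /G; lra.
Qed.

Lemma derive_line (h : 'cV[R]_d -> R) x v (t : R) :
  differentiable h (x + t *: v) ->
  is_derive t 1 (fun t : R => h (x + t *: v)) ('D_v h (x + t *: v)).
Proof.
move=> hd; have hv : derivable h (x + t *: v) v by exact: diff_derivable.
have E : (fun e : R => e^-1 *:
    (((fun t : R => h (x + t *: v)) \o shift t) (e *: 1) - h (x + t *: v)))
  = (fun e => e^-1 *: ((h \o shift (x + t *: v)) (e *: v) - h (x + t *: v))).
  apply/funext => e /=; congr (_ *: (h _ - _)).
  by rewrite [e%:A]mulr1 scalerDl addrCA.
by split; rewrite /derivable /derive E.
Qed.

Lemma derive_coords (h : 'cV[R]_d -> R) z v : differentiable h z ->
  'D_v h z = \sum_i 'D_(delta_mx i ord0) h z * v i ord0.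
Proof.
move=> hd; rewrite deriveE // {1}[v]matrix_sum_delta.
rewrite linear_sum /=; apply: eq_bigr => i _.
rewrite big_ord1 linearZ /= mulrC deriveE //.
Qed.

Lemma derive_gradient (f : 'cV[R]_d -> R) z v : differentiable f z ->
  'D_v f z = mdot (gradient f z) v.
Proof.
move=> fd; rewrite derive_coords // mdotE; apply: eq_bigr => i _.
by rewrite big_ord1 mxE.
Qed.

Lemma differentiable_gradient_coord (f : 'cV[R]_d -> R) z i :
  differentiable (gradient f) z ->
  differentiable (fun z => gradient f z i ord0 : R) z.
Proof.
move=> gd.
exact: (@differentiable_comp _ _ _ _ (gradient f)
  (fun N : 'cV[R]_d => N i ord0) z gd (differentiable_coord _ _ _)).
Qed.

Lemma derive_hessian (f : 'cV[R]_d -> R) z v i : differentiable (gradient f) z ->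
  'D_v (fun z => gradient f z i ord0) z = (hessian f z *m v) i ord0.
Proof.
move=> gd; rewrite derive_coords; last exact: differentiable_gradient_coord.
by rewrite mxE; apply: eq_bigr => j _; rewrite mxE.
Qed.

Lemma derive_line_gradient (f : 'cV[R]_d -> R) x v u (t : R) :
  differentiable (gradient f) (x + t *: v) ->
  is_derive t 1 (fun t : R => mdot u (gradient f (x + t *: v)))
    (mdot u (hessian f (x + t *: v) *m v)).
Proof.
move=> gd.
have -> : (fun t : R => mdot u (gradient f (x + t *: v))) =
    \sum_(i < d) (fun t : R => u i ord0 * gradient f (x + t *: v) i ord0).
  by apply/funext => s; rewrite mdotE fct_sumE; apply: eq_bigr => i _; rewrite big_ord1.
have -> : mdot u (hessian f (x + t *: v) *m v) =
    \sum_(i < d) u i ord0 * (hessian f (x + t *: v) *m v) i ord0.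
  by rewrite mdotE; apply: eq_bigr => i _; rewrite big_ord1.
apply: is_derive_sum => i.
have gi := derive_line (differentiable_gradient_coord i gd).
rewrite -derive_hessian //.
exact: (@is_deriveZ _ _ _ (fun t : R => gradient f (x + t *: v) i ord0) (u i ord0)).
Qed.

Lemma gradient_min0 (f : 'cV[R]_d -> R) xs :
  (forall z, differentiable f z) -> (forall z, f xs <= f z) -> gradient f xs = 0.
Proof.
move=> fd fmin; apply/eqP; rewrite -mdot_eq0; apply/eqP.
set v := {2}(gradient f xs).
have der0 : is_derive (0 : R) 1 (fun t : R => f (xs + t *: v)) 0.
  apply: (@derive1_at_min _ _ (-1) 1); rewrite ?in_itv /=; try lra.
    by move=> t _; have := derive_line (fd (xs + t *: v)) => ?; exact: ex_derive.
  by move=> t _ /=; rewrite scale0r addr0.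
have := derive_line (v := v) (t := 0) (fd (xs + 0 *: v)).
rewrite derive_gradient // scale0r addr0 => -[_ <-].
by case: der0.
Qed.

Lemma opnorm_bound (A : 'M[R]_d) v : mnorm (A *m v) <= opnorm A * mnorm v.
Proof.
have ub : has_ubound [set enorm (A *m v) | v in [set v : 'cV[R]_d | enorm v <= 1]].
  exists (mnorm A) => _ /= [w w1 <-]; rewrite !enormE in w1 *.
  by apply: le_trans (mnorm_mulmx _ _) _; rewrite ler_piMr ?mnorm_ge0.
have [->|v0] := eqVneq v 0; first by rewrite mulmx0 !mnorm0 mulr0.
have vn := mnorm_gt0 v0.
have : enorm (A *m ((mnorm v)^-1 *: v)) <= opnorm A.
  apply: ub_le_sup => //=; exists ((mnorm v)^-1 *: v) => //=.
  by rewrite enormE mnormZ ger0_norm ?invr_ge0 ?mnorm_ge0 // mulVf ?gt_eqF.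
rewrite enormE -scalemxAr mnormZ ger0_norm ?invr_ge0 ?mnorm_ge0 // => h.
by rewrite -ler_pdivrMr // mulrC.
Qed.

End LineCalculus.

Section LocalModel.
Context {R : realType} {d : nat} (f : 'cV[R]_d -> R) (xs : 'cV[R]_d) (mu M : R).
Context (f_diff : forall x, differentiable f x).
Context (g_diff : forall x, differentiable (gradient f) x).
Context (mu_gt0 : 0 < mu) (f_sconvex : strongly_convex mu f).
Context (xs_min : forall z : 'cV[R]_d, f xs <= f z).
Context (M_ge0 : 0 <= M).
Context (hess_lip : forall z : 'cV[R]_d,
  opnorm (hessian f z - hessian f xs) <= M * enorm (z - xs)).
Local Notation H := (hessian f xs).
Implicit Types (u v w x : 'cV[R]_d).

(** The mean value theorem fails for vector-valued maps, so the gradient is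
    tested against a fixed [u]; choosing [u] afterwards recovers norm estimates.
    The bound [a + b t] on the distance to [xs] keeps the factor 1/2 that
    integration would give on a segment starting at [xs]. *)
Lemma gradient_increment u x v (a b : R) :
  (forall t : R, 0 <= t <= 1 -> mnorm (x + t *: v - xs) <= a + b * t) ->
  mdot u (gradient f (x + v) - gradient f x - H *m v)
  <= M * (a + b / 2) * (mnorm u * mnorm v).
Proof.
move=> path; set P := mnorm u * mnorm v.
have P0 : 0 <= P by rewrite mulr_ge0 ?mnorm_ge0.
have := @increment_le _ _ _ (mdot u (H *m v) + M * a * P) (M * b * P) 0
  (fun t => derive_line_gradient u (g_diff (x + t *: v))).
rewrite scale1r scale0r addr0 => incr.
rewrite mdotDr mdotNr mdotDr mdotNr.
suff {}/incr : forall t : R, 0 <= t <= 1 -> mdot u (hessian f (x + t *: v) *m v)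
   <= mdot u (H *m v) + M * a * P + M * b * P * t + 0 * t ^+ 2 by lra.
move=> t t01.
have -> : hessian f (x + t *: v) *m v
   = H *m v + (hessian f (x + t *: v) - H) *m v by rewrite mulmxBl [RHS]addrC subrK.
rewrite mdotDr -!addrA lerD2l mul0r addr0.
apply: le_trans (ler_norm _) _; apply: le_trans (mdot_le_norm _ _) _.
apply: (@le_trans _ _ (mnorm u * (M * (a + b * t) * mnorm v))); last first.
  by rewrite /P; lra.
rewrite ler_wpM2l ?mnorm_ge0 //; apply: le_trans (opnorm_bound _ _) _.
rewrite ler_wpM2r ?mnorm_ge0 //; apply: le_trans (hess_lip _) _.
by rewrite enormE ler_wpM2l // path.
Qed.

Lemma gradient_xs : gradient f xs = 0.
Proof. exact: gradient_min0. Qed.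

Lemma gradient_model v w :
  `|mdot v (gradient f (xs + w)) - mdot v (H *m w)|
  <= M / 2 * (mnorm w ^+ 2 * mnorm v).
Proof.
have path (t : R) : 0 <= t <= 1 -> mnorm (xs + t *: w - xs) <= 0 + mnorm w * t.
  by move=> /andP[t0 _]; rewrite addrAC subrr add0r mnormZ ger0_norm // add0r mulrC.
have := gradient_increment (- v) path; have := gradient_increment v path.
rewrite gradient_xs subr0 mnormN mdotNl mdotDr mdotNr add0r => h1 h2.
rewrite ler_norml; apply/andP; split; lra.
Qed.

Lemma value_model v :
  `|f (xs + v) - f xs - mdot v (H *m v) / 2| <= M / 6 * mnorm v ^+ 3.
Proof.
pose K := mdot v (H *m v).
have Fder (t : R) : is_derive t 1 (fun t : R => f (xs + t *: v))
    (mdot v (gradient f (xs + t *: v))).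
  by rewrite mdotC -derive_gradient //; exact: derive_line.
have dF (t : R) : 0 <= t <= 1 ->
   `|mdot v (gradient f (xs + t *: v)) - t * K| <= M / 2 * mnorm v ^+ 3 * t ^+ 2.
  move=> /andP[t0 _]; have := gradient_model v (t *: v).
  rewrite -scalemxAr mdotZr mnormZ (ger0_norm t0) -/K.
  by move=> /le_trans; apply; rewrite le_eqVlt; apply/orP; left; apply/eqP; ring.
have up := increment_le (a := 0) (b := K) (c := M / 2 * mnorm v ^+ 3) Fder.
have NFder (t : R) : is_derive t 1 (fun t : R => - f (xs + t *: v))
    (- mdot v (gradient f (xs + t *: v))) by have := Fder t => ?; exact: is_deriveN.
have lo := increment_le (a := 0) (b := - K) (c := M / 2 * mnorm v ^+ 3) NFder.
move: up lo; rewrite !scale1r !scale0r !addr0 => up lo.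
have {}up : f (xs + v) - f xs <= 0 + K / 2 + M / 2 * mnorm v ^+ 3 / 3.
  by apply: up => t /dF; rewrite ler_norml => /andP[_]; lra.
have {}lo : - f (xs + v) - - f xs <= 0 + - K / 2 + M / 2 * mnorm v ^+ 3 / 3.
  by apply: lo => t /dF; rewrite ler_norml => /andP[+ _]; lra.
rewrite ler_norml -/K; apply/andP; split; lra.
Qed.

(** This is the increment of [f] along the second side of the broken path
    [xs], [xs + u], [xs + u + v]; [value_model] is the first side. *)
Lemma value_increment_model u v :
  `|f (xs + u + v) - f (xs + u) - mdot v (H *m u) - mdot v (H *m v) / 2|
  <= M / 2 * ((mnorm u + mnorm v) ^+ 2 * mnorm v).
Proof.
pose K := mdot v (H *m v); pose L := mdot v (H *m u).
set C := M / 2 * _.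
have Fder (t : R) : is_derive t 1 (fun t : R => f (xs + u + t *: v))
    (mdot v (gradient f (xs + u + t *: v))).
  by rewrite mdotC -derive_gradient //; exact: derive_line.
have dF (t : R) : 0 <= t <= 1 ->
   `|mdot v (gradient f (xs + u + t *: v)) - (L + t * K)| <= C.
  move=> /andP[t0 t1]; have := gradient_model v (u + t *: v).
  rewrite addrA mulmxDr -scalemxAr mdotDr mdotZr -/K -/L.
  move=> /le_trans; apply; rewrite /C ler_wpM2l ?divr_ge0 // ler_wpM2r ?mnorm_ge0 //.
  rewrite ler_pXn2r ?nnegrE ?addr_ge0 ?mnorm_ge0 //.
  apply: le_trans (mnormD _ _) _; rewrite lerD2l mnormZ (ger0_norm t0).
  by rewrite ler_piMl ?mnorm_ge0.
have up := increment_le (a := L + C) (b := K) (c := 0) Fder.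
have NFder (t : R) : is_derive t 1 (fun t : R => - f (xs + u + t *: v))
    (- mdot v (gradient f (xs + u + t *: v))) by have := Fder t => ?; exact: is_deriveN.
have lo := increment_le (a := - L + C) (b := - K) (c := 0) NFder.
move: up lo; rewrite !scale1r !scale0r !addr0 => up lo.
have {}up : f (xs + u + v) - f (xs + u) <= L + C + K / 2 + 0 / 3.
  by apply: up => t /dF; rewrite ler_norml => /andP[_]; lra.
have {}lo : - f (xs + u + v) - - f (xs + u) <= - L + C + - K / 2 + 0 / 3.
  by apply: lo => t /dF; rewrite ler_norml => /andP[+ _]; lra.
rewrite ler_norml -/K -/L; apply/andP; split; lra.
Qed.

Lemma cubic_domination (a b : R) :
  (forall t : R, 0 < t -> t ^+ 2 * a <= t ^+ 3 * b) -> a <= 0.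
Proof.
move=> h; rewrite leNgt; apply/negP => a0.
have b0 : 0 < 2 * (`|b| + 1) by rewrite mulr_gt0 // ltr_wpDl.
(* at this [t] the right-hand side is at most half of the left-hand side *)
have t0 : 0 < a / (2 * (`|b| + 1)) by rewrite divr_gt0.
have := h _ t0; set t := _ / _ in t0 *.
have -> : t ^+ 3 * b = t ^+ 2 * (t * b) by ring.
rewrite ler_pM2l ?exprn_gt0 // => le_a.
have : t * b <= a / 2.
  apply: (@le_trans _ _ (t * (`|b| + 1))).
    by rewrite ler_pM2l //; have := ler_norm b; lra.
  have -> // : t * (`|b| + 1) = a / 2.
  by rewrite /t; field; rewrite gt_eqF // ltr_wpDl.
lra.
Qed.

Lemma mdot_delta (A : 'M[R]_d) (k l : 'I_d) :
  mdot (delta_mx k ord0 : 'cV[R]_d) (A *m (delta_mx l ord0 : 'cV[R]_d)) = A k l.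
Proof.
rewrite mdotE (bigD1 k) //= [X in _ + X]big1 ?addr0 => [|m mk]; last first.
  by rewrite big_ord1 mxE (negPf mk) mul0r.
rewrite big_ord1 mxE !eqxx mul1r mxE (bigD1 l) //= mxE !eqxx mulr1 big1 ?addr0 //.
by move=> m /negPf ml; rewrite mxE ml mulr0.
Qed.

(** The point [xs + u + v] is reached through [xs + u] or through [xs + v].  The
    two quadratic models of its value differ by [v . H u - u . H v], while the
    errors are cubic; rescaling [u] and [v] shows that the difference vanishes. *)
Lemma hessian_xs_sym : H^T = H.
Proof.
have D u v : `|f (xs + u + v) - f xs - mdot u (H *m u) / 2 - mdot v (H *m v) / 2
     - mdot v (H *m u)| <= M * (mnorm u + mnorm v) ^+ 3.
  have := value_model u; have := value_increment_model u v.
  set a := mnorm u; set b := mnorm v.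
  have a0 : 0 <= a by exact: mnorm_ge0.
  have b0 : 0 <= b by exact: mnorm_ge0.
  have h1 : M / 2 * ((a + b) ^+ 2 * b) <= M / 2 * (a + b) ^+ 3.
    by rewrite [(a + b) ^+ 3]exprSr ler_wpM2l ?divr_ge0 // ler_wpM2l ?sqr_ge0 // lerDr.
  have h2 : M / 6 * a ^+ 3 <= M / 2 * (a + b) ^+ 3.
    have Mab : M * a ^+ 3 <= M * (a + b) ^+ 3.
      by rewrite ler_wpM2l // ler_pXn2r ?nnegrE ?addr_ge0 // lerDl.
    have : 0 <= M * a ^+ 3 by rewrite mulr_ge0 ?exprn_ge0.
    lra.
  rewrite !ler_norml => /andP[? ?] /andP[? ?]; apply/andP; split; lra.
have sym u v : mdot v (H *m u) - mdot u (H *m v) <= 0.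
  apply: (@cubic_domination _ (2 * M * (mnorm u + mnorm v) ^+ 3)) => t t0.
  have := D (t *: u) (t *: v); have := D (t *: v) (t *: u).
  rewrite [xs + t *: u + t *: v]addrAC !ler_norml -!scalemxAr !(mdotZl, mdotZr).
  rewrite !mnormZ (ger0_norm (ltW t0)); move=> /andP[? ?] /andP[? ?]; lra.
apply/matrixP => i j; rewrite mxE.
have := sym (delta_mx i ord0) (delta_mx j ord0).
have := sym (delta_mx j ord0) (delta_mx i ord0).
rewrite !mdot_delta; lra.
Qed.

(** In the strong convexity inequality on the segment from [xs] to [xs + v], the
    left-hand side is at least [f xs]; dividing by the parameter and letting it tend to 0 gives the bound. *)
Lemma quadratic_growth v : mu / 2 * mnorm v ^+ 2 <= f (xs + v) - f xs.
Proof.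
have h (t : R) : 0 < t < 1 -> mu / 2 * (1 - t) * mnorm v ^+ 2 <= f (xs + v) - f xs.
  move=> /andP[t0 t1].
  have t01 : 0 <= t <= 1 by rewrite !ltW.
  have := le_trans (xs_min _) (f_sconvex (xs + v) xs t01).
  rewrite enormE [xs + v - xs]addrAC subrr add0r => hh.
  by rewrite -(ler_pM2l t0); lra.
rewrite -subr_le0; apply: (@cubic_domination _ (mu / 2 * mnorm v ^+ 2)) => t t0.
rewrite [t ^+ 3]exprSr -[leRHS]mulrA ler_pM2l ?exprn_gt0 //.
have [t1|t1] := ltP t 1; first by have := h t; rewrite t0 t1 => /(_ isT); lra.
have := xs_min (xs + v); have : mu / 2 * mnorm v ^+ 2 <= t * (mu / 2 * mnorm v ^+ 2).
  by rewrite ler_peMl // mulr_ge0 ?sqr_ge0 // divr_ge0 // ltW.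
lra.
Qed.

(** Quadratic growth and the quadratic model agree up to a cubic error, so the
    inequality between the quadratic terms holds in the limit of small [v]. *)
Lemma hessian_xs_lower v : mu * mdot v v <= mdot v (H *m v).
Proof.
rewrite -mnorm_sqr -subr_le0.
apply: (@cubic_domination _ (M / 3 * mnorm v ^+ 3)) => t t0.
have := quadratic_growth (t *: v); have := value_model (t *: v).
rewrite -scalemxAr mdotZr mdotZl mnormZ (ger0_norm (ltW t0)) ler_norml => /andP[_].
lra.
Qed.

Lemma hessian_xs_posdef : posdefmx H.
Proof.
split; first exact: hessian_xs_sym.
move=> v v0; rewrite vdotE; apply: lt_le_trans (hessian_xs_lower v).
by rewrite mulr_gt0 ?mdot_gt0.
Qed.

End LocalModel.

(** * Preconditioning by the Hessian at the minimizer *)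

Section Preconditioning.
Context {R : realType} {d : nat}.
Implicit Types (H T S : 'M[R]_d).

Lemma posdefmx_unit H : posdefmx H -> H \in unitmx.
Proof.
move=> [Hsym Hpos]; rewrite -row_free_unit -kermx_eq0; apply/rowV0P => v.
move=> /sub_kermxP vH; apply: trmx_inj; rewrite trmx0; apply/eqP.
apply: contraT => /Hpos; have -> : H *m v^T = 0 by rewrite -{1}Hsym -trmx_mul vH trmx0.
by rewrite /vdot mulmx0 mxE ltxx.
Qed.

Lemma posdefmx_inv H : posdefmx H -> posdefmx (invmx H).
Proof.
move=> Hpd; have Hu := posdefmx_unit Hpd; have [Hsym Hpos] := Hpd.
split; first by rewrite trmx_inv Hsym.
move=> v v0; pose w := invmx H *m v.
have vw : v = H *m w by rewrite mulKVmx.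
have w0 : w != 0 by apply: contra v0 => /eqP w0; rewrite vw w0 mulmx0.
by rewrite -/w {1}vw vdotE mdotC -vdotE; exact: Hpos.
Qed.

(** With [T = H^(-1/2)], the inverse of [T] is [S = T H].  The length of
    [H^(1/2) v] depends on [H] only through [v . H v], so it is also the length
    of [S *m v]. *)
Lemma preconditioner H : posdefmx H ->
  exists S, [/\ (sqrtmx (invmx H))^T = sqrtmx (invmx H), S^T = S,
    sqrtmx (invmx H) *m S = 1%:M, S *m S = H
    & forall v : 'cV[R]_d, mnorm (sqrtmx H *m v) = mnorm (S *m v)].
Proof.
move=> Hpd; have Hu := posdefmx_unit Hpd.
have [[Tsym _] TT] := sqrtmxP (posdefmx_inv Hpd).
have [[Rsym _] RR] := sqrtmxP Hpd.
set T := sqrtmx (invmx H) in Tsym TT *; exists (T *m H).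
have TTH : T *m (T *m H) = 1%:M by rewrite mulmxA TT mulVmx.
have THT : T *m H *m T = 1%:M by exact: mulmx1C.
have Ssym : (T *m H)^T = T *m H.
  have Hsym := Hpd.1; rewrite trmx_mul Tsym Hsym.
  have HTT : H *m T *m T = 1%:M by apply: mulmx1C; rewrite mulmxA.
  by have := congr1 (mulmx^~ (T *m H)) HTT; rewrite /= mul1mx -mulmxA TTH mulmx1.
have SS : T *m H *m (T *m H) = H by rewrite mulmxA THT mul1mx.
split=> // v; rewrite /mnorm; congr Num.sqrt.
by rewrite mdot_adj Rsym mulmxA RR [RHS]mdot_adj Ssym mulmxA SS.
Qed.

Lemma mx_norm_le_mnorm (v : 'cV[R]_d) : `|v| <= mnorm v.
Proof.
have [v0|v0] := eqVneq (mx_norm v) 0; first by rewrite [leLHS]v0 mnorm_ge0.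
have [[i j] /= vij] := mx_norm_neq0 v0; rewrite [leLHS]vij ord1.
rewrite -[leLHS]sqrtr_sqr ler_wsqrtr // mdotE (bigD1 i) //= big_ord1 expr2 lerDl.
by rewrite sumr_ge0 // => k _; rewrite big_ord1 -expr2 sqr_ge0.
Qed.

Lemma cvg_geometric (u : nat -> 'cV[R]_d) (l : 'cV[R]_d) (C rho : R) :
  0 < rho < 1 -> (forall k, mnorm (u k - l) <= C * rho ^+ k) -> u k @[k --> \oo] --> l.
Proof.
move=> /andP[rho0 rho1] ul.
have geo : (fun k => C * rho ^+ k) @ \oo --> (0 : R).
  rewrite -[X in _ --> X](mulr0 C); apply: cvgMr; apply: cvg_expr.
  by rewrite ger0_norm // ltW.
apply/cvgrPdist_le => e e0.
move/cvgrPdist_le : geo => /(_ e e0); apply: filterS => k /=.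
rewrite sub0r normrN => h; rewrite distrC (le_trans (mx_norm_le_mnorm _)) //.
by rewrite (le_trans (ul k)) // (le_trans (ler_norm _)).
Qed.

End Preconditioning.

Section PreconditionedModel.
Context {R : realType} {d : nat} (f : 'cV[R]_d -> R) (xs : 'cV[R]_d) (mu M : R).
Context (f_diff : forall x : 'cV[R]_d, differentiable f x).
Context (g_diff : forall x : 'cV[R]_d, differentiable (gradient f) x).
Context (mu_gt0 : 0 < mu) (f_sconvex : strongly_convex mu f).
Context (xs_min : forall z : 'cV[R]_d, f xs <= f z).
Context (M_ge0 : 0 <= M).
Context (hess_lip : forall z : 'cV[R]_d,
  opnorm (hessian f z - hessian f xs) <= M * enorm (z - xs)).
Local Notation H := (hessian f xs).
Context (T S : 'M[R]_d).
Context (Tsym : T^T = T) (Ssym : S^T = S) (TS : T *m S = 1%:M) (SS : S *m S = H).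
Local Notation c := (M / mu `^ (3 / 2)).
Implicit Types (u v w x : 'cV[R]_d).

Lemma precond_hessian : T *m H = S.
Proof. by rewrite -SS mulmxA TS mul1mx. Qed.

Lemma hessian_form v : mdot v (H *m v) = mnorm (S *m v) ^+ 2.
Proof. by rewrite mnorm_sqr -SS -mulmxA mdot_adj Ssym. Qed.

Lemma norm_le_precond v : mnorm v <= mnorm (S *m v) / Num.sqrt mu.
Proof.
have s0 : 0 < Num.sqrt mu by rewrite sqrtr_gt0.
rewrite ler_pdivlMr // -(ler_pXn2r (ltn0Sn 1)) ?nnegrE ?mulr_ge0 ?mnorm_ge0 ?(ltW s0) //.
rewrite exprMn [Num.sqrt mu ^+ 2]sqr_sqrtr ?(ltW mu_gt0) // -hessian_form mnorm_sqr mulrC.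
exact: (hessian_xs_lower f_diff g_diff mu_gt0 f_sconvex xs_min M_ge0 hess_lip).
Qed.

Lemma norm_precond_le u : mnorm (T *m u) <= mnorm u / Num.sqrt mu.
Proof.
have := norm_le_precond (T *m u).
by rewrite mulmxA (mulmx1C TS) mul1mx.
Qed.

Lemma cubic_const_ge0 : 0 <= c.
Proof. by rewrite divr_ge0 // powR_ge0. Qed.

Lemma cubic_constE : c = M / (mu * Num.sqrt mu).
Proof.
congr (_ / _); have -> : 3 / 2 = 1 + 2^-1 :> R by field.
by rewrite powRD ?(gt_eqF mu_gt0) ?implybT // powRr1 ?ltW // powR12_sqrt // ltW.
Qed.

(** The three factors [1 / sqrt mu] that appear when lengths are measured after
    preconditioning are the [mu^(3/2)] of the statement. *)
Lemma cubic_const_scale (a b e : R) : 0 <= a -> 0 <= b -> 0 <= e ->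
  M * (a / Num.sqrt mu) * ((b / Num.sqrt mu) * (e / Num.sqrt mu)) = c * (a * b * e).
Proof.
move=> a0 b0 e0; rewrite cubic_constE -{4}(sqr_sqrtr (ltW mu_gt0)).
by field; rewrite gt_eqF // sqrtr_gt0.
Qed.

(** The squared norm of the error vector [e] is its pairing with [e]; moving the
    symmetric matrix [T] across the pairing gives the estimate of the gradient
    tested against [T *m e]. *)
Lemma preconditioned_gradient w :
  mnorm (T *m gradient f (xs + w) - S *m w) <= c * mnorm (S *m w) / 2 * mnorm (S *m w).
Proof.
set e := _ - _; have [->|e0] := eqVneq e 0.
  by rewrite mnorm0 mulr_ge0 ?mnorm_ge0 // divr_ge0 // mulr_ge0 ?cubic_const_ge0 ?mnorm_ge0.
have en := mnorm_gt0 e0; rewrite -(ler_pM2l en) -expr2 mnorm_sqr.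
have eE : e = T *m (gradient f (xs + w) - H *m w) by rewrite mulmxBr mulmxA precond_hessian.
rewrite {2}eE mdot_adj Tsym mdotDr mdotNr.
have := gradient_model f_diff g_diff xs_min M_ge0 hess_lip (T *m e) w.
move=> /(le_trans (ler_norm _))/le_trans; apply.
apply: (@le_trans _ _ (M / 2 * ((mnorm (S *m w) / Num.sqrt mu) ^+ 2
                             * (mnorm e / Num.sqrt mu)))).
  rewrite ler_wpM2l ?divr_ge0 // ler_pM ?sqr_ge0 ?mnorm_ge0 ?norm_precond_le //.
  by rewrite ler_pXn2r ?nnegrE ?divr_ge0 ?mnorm_ge0 ?sqrtr_ge0 ?norm_le_precond.
have := cubic_const_scale (mnorm_ge0 (S *m w)) (mnorm_ge0 (S *m w)) (mnorm_ge0 e); lra.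
Qed.

(** As for [preconditioned_gradient].  The distance to [xs] along the segment is
    bounded by its larger endpoint value after preconditioning. *)
Lemma preconditioned_secant x x' :
  mnorm ((T *m gradient f x' - T *m gradient f x) - (S *m x' - S *m x))
  <= c * Num.max (mnorm (S *m (x - xs))) (mnorm (S *m (x' - xs)))
       * mnorm (S *m x' - S *m x).
Proof.
set m := Num.max _ _; pose v := x' - x.
have m0 : 0 <= m by rewrite le_max mnorm_ge0.
rewrite -!mulmxBr -/v; set e := _ - _; have [->|e0] := eqVneq e 0.
  by rewrite mnorm0 mulr_ge0 ?mnorm_ge0 // mulr_ge0 ?cubic_const_ge0.
have en := mnorm_gt0 e0; rewrite -(ler_pM2l en) -expr2 mnorm_sqr.
have eE : e = T *m (gradient f x' - gradient f x - H *m v) by rewrite mulmxBr mulmxA precond_hessian.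
rewrite {2}eE mdot_adj Tsym.
have x'E : x' = x + v by rewrite addrC subrK.
have path (t : R) : 0 <= t <= 1 -> mnorm (x + t *: v - xs) <= m / Num.sqrt mu + 0 * t.
  move=> /andP[t0 t1]; rewrite mul0r addr0.
  have -> : x + t *: v - xs = (1 - t) *: (x - xs) + t *: (x' - xs).
    by rewrite /v; apply/colP => i; rewrite !mxE; ring.
  apply: le_trans (norm_le_precond _) _; rewrite ler_pM2r ?invr_gt0 ?sqrtr_gt0 //.
  rewrite mulmxDr -!scalemxAr (le_trans (mnormD _ _)) // !mnormZ.
  rewrite !ger0_norm ?subr_ge0 //.
  have -> : m = (1 - t) * m + t * m by ring.
  by rewrite lerD // ler_wpM2l ?subr_ge0 // le_max lexx ?orbT.
have := gradient_increment g_diff M_ge0 hess_lip (T *m e) path.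
rewrite -x'E => /le_trans; apply; rewrite mul0r addr0.
apply: (@le_trans _ _ (M * (m / Num.sqrt mu) * 
  (mnorm e / Num.sqrt mu * (mnorm (S *m v) / Num.sqrt mu)))).
  rewrite ler_wpM2l ?mulr_ge0 ?invr_ge0 ?sqrtr_ge0 //.
  by rewrite ler_pM ?mnorm_ge0 ?norm_precond_le ?norm_le_precond.
rewrite cubic_const_scale ?mnorm_ge0 //; lra.
Qed.

Lemma preconditioned_value w :
  `|f (xs + w) - f xs - mnorm (S *m w) ^+ 2 / 2|
  <= c * mnorm (S *m w) / 6 * mnorm (S *m w) ^+ 2.
Proof.
rewrite -hessian_form; apply: le_trans (value_model f_diff g_diff xs_min M_ge0 hess_lip w) _.
apply: (@le_trans _ _ (M / 6 * (mnorm (S *m w) / Num.sqrt mu) ^+ 3)).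
  rewrite ler_wpM2l ?divr_ge0 //.
  by rewrite ler_pXn2r ?nnegrE ?divr_ge0 ?mnorm_ge0 ?sqrtr_ge0 ?norm_le_precond.
have := cubic_const_scale (mnorm_ge0 (S *m w)) (mnorm_ge0 (S *m w)) (mnorm_ge0 (S *m w)).
rewrite hessian_form; lra.
Qed.

End PreconditionedModel.

(** * The convergence rate *)

Lemma broyden_factor_bound (R : realType) (delta phi : R) :
  0 < delta < 1 / 2 -> 0 <= phi <= 1 ->
  let w := phi + (1 - phi) * ((1 - 2 * delta) / (1 + 2 * delta)) in
  0 < w /\ 1 <= 1 / w <= (1 + 2 * delta) / (1 - 2 * delta).
Proof.
move=> /andP[delta0 delta1] /andP[phi0 phi1].
set kap := (1 - 2 * delta) / (1 + 2 * delta) => w.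
have kap0 : 0 < kap by rewrite divr_gt0; lra.
have kap1 : kap <= 1 by rewrite ler_pdivrMr; lra.
have h : (1 - phi) * kap <= (1 - phi) * 1 by rewrite ler_wpM2l; lra.
have h' : phi * kap <= phi * 1 by rewrite ler_wpM2l.
have wk : kap <= w by rewrite /w; lra.
have w0 : 0 < w by apply: lt_le_trans wk.
split=> //; apply/andP; split.
  by rewrite ler_pdivlMr // mul1r /w; lra.
have -> : (1 + 2 * delta) / (1 - 2 * delta) = kap^-1 by rewrite invf_div.
by rewrite div1r lef_pV2 // posrE.
Qed.

(** The elementary inequality behind it is
    [1 + eps / 3 <= (1 + eps / 2)^2 (1 - eps / 3)], valid for small [eps]. *)
Lemma value_ratio_bound (R : realType) (eps t0 t F0 F : R) :
  0 < eps < 1 / 2 -> 0 < t0 -> 0 <= t ->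
  F <= (1 / 2 + eps / 6) * t ^+ 2 -> (1 / 2 - eps / 6) * t0 ^+ 2 <= F0 ->
  F / F0 <= (1 + eps / 2) ^+ 2 * (t / t0) ^+ 2.
Proof.
move=> /andP[eps0 eps1] t0_gt0 t_ge0 FU F0L.
have e0 : 0 < (1 / 2 - eps / 6) * t0 ^+ 2 by rewrite mulr_gt0 ?exprn_gt0 //; lra.
have F0_gt0 : 0 < F0 by apply: lt_le_trans F0L.
rewrite ler_pdivrMr //; apply: le_trans FU _.
apply: (@le_trans _ _ ((1 + eps / 2) ^+ 2 * (t / t0) ^+ 2
                       * ((1 / 2 - eps / 6) * t0 ^+ 2))); last first.
  by rewrite ler_wpM2l // mulr_ge0 ?sqr_ge0.
have -> : (1 + eps / 2) ^+ 2 * (t / t0) ^+ 2 * ((1 / 2 - eps / 6) * t0 ^+ 2)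
   = (1 + eps / 2) ^+ 2 * (1 / 2 - eps / 6) * t ^+ 2 by field; rewrite gt_eqF.
rewrite ler_wpM2r ?sqr_ge0 //; nra.
Qed.

Theorem theorem4p5 (R : realType) (d : nat) (f : 'cV[R]_d -> R)
  (mu L M : R) (xs : 'cV[R]_d) (phi : nat -> R)
  (x : nat -> 'cV[R]_d) (B : nat -> 'M[R]_d) (eps delta rho : R)
  (f_diff2 : twice_differentiable f)
  (mu_gt0 : 0 < mu) (f_sconvex : strongly_convex mu f)
  (L_gt0 : 0 < L) (f_smooth : gradient_lipschitz L f)
  (xs_min : forall z : 'cV[R]_d, f xs <= f z)
  (M_ge0 : 0 <= M)
  (hess_lip : forall z : 'cV[R]_d,
     opnorm (hessian f z - hessian f xs) <= M * enorm (z - xs))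
  (phi01 : forall k : nat, 0 <= phi k <= 1)
  (B0_posdef : posdefmx (B 0%N))
  (iter : broyden_iterates f phi x B)
  (s_neq0 : forall k : nat, x k.+1 - x k != 0)
  (eps_bnd : 0 < eps < 1 / 2) (delta_bnd : 0 < delta < 1 / 2)
  (rho_bnd : 0 < rho < 1)
  (x0_close : M / mu `^ (3 / 2) * enorm (sqrtmx (hessian f xs) *m (x 0%N - xs))
     <= eps)
  (B0_close : frobenius (sqrtmx (invmx (hessian f xs))
       *m (B 0%N - hessian f xs) *m sqrtmx (invmx (hessian f xs))) <= delta)
  (cond1 : sup (range (fun k : nat =>
         phi k * (2 * delta + 1) * (4 / (1 - eps) ^+ 2)
         + (3 + eps) / (1 - eps)))
       * (eps / (1 - rho)) <= delta)
  (cond2 : eps / 2 + 2 * delta <= (1 - 2 * delta) * rho) :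
  let q : R := sup (range (fun k : nat =>
    Num.sqrt (1 / (phi k + (1 - phi k) * ((1 - 2 * delta) / (1 + 2 * delta))))))
  in
  let rate (k : nat) : R :=
    (2 * Num.sqrt 2 * delta * (1 + rho) * (1 + eps / 2) * q * Num.sqrt k%:R
     + (1 + rho) * (1 + eps / 2) * eps / (2 * (1 - rho))) / k%:R in
  [/\ 1 <= q <= Num.sqrt ((1 + 2 * delta) / (1 - 2 * delta)),
      x k @[k --> \oo] --> xs,
      forall k : nat, (1 <= k)%N ->
        enorm (sqrtmx (hessian f xs) *m (x k - xs))
          / enorm (sqrtmx (hessian f xs) *m (x 0%N - xs)) <= rate k ^+ k
    & forall k : nat, (1 <= k)%N ->
        (f (x k) - f xs) / (f (x 0%N) - f xs)
          <= (1 + eps / 2) ^+ 2 * rate k ^+ (2 * k)].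
Proof.
have [f_diff g_diff] := f_diff2.
have Hpd := hessian_xs_posdef f_diff g_diff mu_gt0 f_sconvex xs_min M_ge0 hess_lip.
have [S [Tsym Ssym TS SS normS]] := preconditioner Hpd.
set H := hessian f xs in Hpd Tsym TS SS normS x0_close B0_close *.
set T := sqrtmx (invmx H) in Tsym TS B0_close.
have ST : S *m T = 1%:M by exact: mulmx1C.
pose c := M / mu `^ (3 / 2).
have c0 : 0 <= c by rewrite divr_ge0 // powR_ge0.
have /andP[eps0 eps1] := eps_bnd; have /andP[delta0 delta1] := delta_bnd.
have /andP[rho0 rho1] := rho_bnd.
move=> q rate.
pose Q k := Num.sqrt (1 / (phi k + (1 - phi k) * ((1 - 2 * delta) / (1 + 2 * delta)))).
have factor k := broyden_factor_bound delta_bnd (phi01 k).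
have QU k : Q k <= Num.sqrt ((1 + 2 * delta) / (1 - 2 * delta)).
  by have [_ /andP[_ ?]] := factor k; rewrite ler_wsqrtr.
have Qq k : Q k <= q.
  apply: ub_le_sup; last by exists k.
  by exists (Num.sqrt ((1 + 2 * delta) / (1 - 2 * delta))) => _ [j _ <-]; exact: QU.
have Q1 k : 1 <= Q k.
  by have [_ /andP[? _]] := factor k; rewrite -[1]sqrtr1 ler_wsqrtr.
have q1 : 1 <= q by apply: le_trans (Q1 0%N) (Qq 0%N).
have q0 : 0 < q by apply: lt_le_trans q1.
have qU : q <= Num.sqrt ((1 + 2 * delta) / (1 - 2 * delta)).
  by apply: ge_sup; [exists (Q 0%N), 0%N | move=> _ [j _ <-]; exact: QU].
have q_bnd k : 1 <= q ^+ 2 * (phi k + (1 - phi k) * ((1 - 2 * delta) / (1 + 2 * delta))).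
  have [w0 /andP[w1 _]] := factor k; rewrite -ler_pdivrMr //.
  have -> : 1 / (phi k + (1 - phi k) * ((1 - 2 * delta) / (1 + 2 * delta))) = Q k ^+ 2.
    by rewrite /Q sqr_sqrtr // (le_trans ler01).
  by rewrite ler_pXn2r ?nnegrE ?sqrtr_ge0 // ltW.
have cond1' k : (phi k * (2 * delta + 1) * (4 / (1 - eps) ^+ 2) + (3 + eps) / (1 - eps))
    * (eps / (1 - rho)) <= delta.
  have er0 : 0 <= eps / (1 - rho) by rewrite divr_ge0 //; lra.
  apply: le_trans cond1; rewrite ler_wpM2r //.
  apply: ub_le_sup; last by exists k.
  exists (1 * (2 * delta + 1) * (4 / (1 - eps) ^+ 2) + (3 + eps) / (1 - eps)).
  move=> _ [j _ <-]; have /andP[_ p1] := phi01 j.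
  rewrite lerD2r ler_wpM2r ?divr_ge0 ?sqr_ge0 // ler_wpM2r //; lra.
pose r k := S *m (x k - xs).
pose g k := T *m gradient f (x k).
pose Bh k := T *m B k *m T.
have rS k : r k.+1 - r k = S *m (x k.+1 - x k).
  by rewrite /r -mulmxBr; congr (_ *m _); apply/colP => i; rewrite !mxE; ring.
have Bsym k : (B k)^T = B k.
  elim: k => [|k IH]; first exact: B0_posdef.1.
  by have [_ ->] := iter k; exact: broyden_update_sym.
have Bh0_sym : (Bh 0%N)^T = Bh 0%N by rewrite /Bh !trmx_mul Tsym Bsym mulmxA.
have Bh0_close : mnorm (Bh 0%N - 1%:M) <= delta.
  move: B0_close; rewrite frobeniusE mulmxBr mulmxBl.
  have -> : T *m H *m T = 1%:M by rewrite -SS mulmxA TS mul1mx ST.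
  by [].
have r_step k : Bh k \in unitmx -> r k.+1 = r k - invmx (Bh k) *m g k.
  move=> Bu; have [xE _] := iter k.
  have BkU : B k \in unitmx by move: Bu; rewrite !unitmx_mul => /andP[/andP[]].
  have invE : invmx (Bh k) = S *m invmx (B k) *m S.
    have e1 : Bh k *m (S *m invmx (B k) *m S) = 1%:M.
      by rewrite /Bh !mulmxA -[_ *m T *m S]mulmxA TS mulmx1 -[T *m _ *m _]mulmxA
        mulmxV // mulmx1 TS.
    by rewrite -[RHS](mulKmx Bu) e1 mulmx1.
  rewrite /r /g invE -!mulmxA [S *m (T *m _)]mulmxA ST mul1mx -mulmxBr.
  by congr (_ *m _); rewrite xE addrAC.
have B_step k : Bh k.+1 = broyden_update (phi k) (Bh k) (r k.+1 - r k) (g k.+1 - g k).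
  have [_ BE] := iter k; rewrite rS /g -mulmxBr /Bh BE.
  by rewrite (broyden_update_congr _ _ _ Tsym Ssym TS (Bsym k)).
have s_neq k : r k.+1 - r k != 0.
  rewrite rS; apply: contra (s_neq0 k) => /eqP Ss0.
  by rewrite -[_ - _]mul1mx -TS -mulmxA Ss0 mulmx0.
have r0_close : c * mnorm (r 0%N) <= eps by move: x0_close; rewrite enormE normS.
have g_close k : mnorm (g k - r k) <= c * mnorm (r k) / 2 * mnorm (r k).
  have := preconditioned_gradient f_diff g_diff mu_gt0 f_sconvex xs_min M_ge0 hess_lip
    Tsym Ssym TS SS (x k - xs).
  by rewrite [xs + _]addrC subrK.
have y_close k : mnorm ((g k.+1 - g k) - (r k.+1 - r k))
    <= c * Num.max (mnorm (r k)) (mnorm (r k.+1)) * mnorm (r k.+1 - r k).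
  have := preconditioned_secant f_diff g_diff mu_gt0 f_sconvex xs_min M_ge0 hess_lip
    Tsym Ssym TS SS (x k) (x k.+1).
  by rewrite -[S *m x k.+1 - _]mulmxBr -rS.
have linear k := iteration_linear_rate phi01 Bh0_sym Bh0_close r_step B_step s_neq
  c0 r0_close g_close y_close eps_bnd delta_bnd rho_bnd cond1' cond2 q0 q_bnd k.
have superlinear k := iteration_superlinear_rate phi01 Bh0_sym Bh0_close r_step B_step s_neq
  c0 r0_close g_close y_close eps_bnd delta_bnd rho_bnd cond1' cond2 q0 q_bnd (k := k).
have rate_ge0 k : 0 <= rate k.
  rewrite divr_ge0 // addr_ge0 //.
    by rewrite !mulr_ge0 ?sqrtr_ge0 // ?(ltW q0) ?(ltW delta0) //; lra.
  by rewrite divr_ge0 // ?mulr_ge0 // ?(ltW eps0); lra.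
have rate_le k : (0 < k)%N -> mnorm (r k) <= rate k ^+ k * mnorm (r 0%N).
  move=> k0; apply: le_trans (superlinear k k0) _.
  have kR : 0 < k%:R :> R by rewrite ltr0n.
  pose A := 2 * Num.sqrt 2 * delta * q * Num.sqrt k%:R.
  pose b := eps / (2 * (1 - rho)).
  have A0 : 0 <= A by rewrite !mulr_ge0 ?sqrtr_ge0 // ltW.
  have b0 : 0 <= b by rewrite divr_ge0 //; lra.
  have e0 : 0 <= eps / 2 by lra.
  have rhoA : 0 <= (1 + rho) * A by rewrite mulr_ge0 //; lra.
  have rateE : rate k =
      ((1 + rho) * A * (1 + eps / 2) + (1 + rho) * (1 + eps / 2) * b) / k%:R.
    by rewrite /rate /A /b; congr (_ / _); ring.
  have leA : (1 + rho) * A <= (1 + rho) * A * (1 + eps / 2) by rewrite ler_peMr //; lra.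
  have leb : b <= (1 + rho) * (1 + eps / 2) * b by rewrite ler_peMl //; nra.
  rewrite ler_wpM2r ?mnorm_ge0 // ler_pXn2r ?nnegrE ?rate_ge0 //; last first.
    by rewrite divr_ge0 // addr_ge0.
  by rewrite rateE ler_pM2r ?invr_gt0 // lerD.
(* an iterate equal to [xs] would be followed by a zero step *)
have r0_gt0 : 0 < mnorm (r 0%N).
  rewrite lt0r mnorm_ge0 andbT; apply: contra (s_neq 0%N) => /eqP r00.
  have := linear 1%N; rewrite r00 mulr0 => r1.
  have norm_eq0 v : mnorm v = 0 -> v = 0 :> 'cV[R]_d.
    by move=> v0; apply/eqP; apply: contraT => /mnorm_gt0; rewrite v0 ltxx.
  apply/eqP; rewrite (norm_eq0 _ r00) subr0; apply: norm_eq0; apply/eqP.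
  by rewrite eq_le r1 mnorm_ge0.
have ratio_le k : (0 < k)%N -> mnorm (r k) / mnorm (r 0%N) <= rate k ^+ k.
  by move=> k0; rewrite ler_pdivrMr // rate_le.
split; first by rewrite q1.
- apply: (@cvg_geometric _ _ _ _ (mnorm (r 0%N) / Num.sqrt mu) rho) => // k.
  apply: le_trans (norm_le_precond f_diff g_diff mu_gt0 f_sconvex xs_min M_ge0 hess_lip Ssym SS _) _.
  by rewrite [leRHS]mulrAC ler_pM2r ?invr_gt0 ?sqrtr_gt0 // [leRHS]mulrC; exact: linear.
- by move=> k k0; rewrite !enormE !normS ratio_le.
- move=> k k0.
  have value j := preconditioned_value f_diff g_diff mu_gt0 f_sconvex xs_min M_ge0 hess_lip
    Ssym SS (x j - xs).
  have crj j : c * mnorm (r j) <= eps.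
    apply: le_trans r0_close; rewrite ler_wpM2l //; apply: le_trans (linear j) _.
    by rewrite ler_piMl ?mnorm_ge0 // exprn_ile1 // ltW.
  have value' j : `|f (x j) - f xs - mnorm (r j) ^+ 2 / 2| <= eps / 6 * mnorm (r j) ^+ 2.
    have := value j; rewrite [xs + _]addrC subrK => /le_trans; apply.
    by rewrite ler_wpM2r ?sqr_ge0 // ler_pM2r ?invr_gt0 //; exact: crj.
  apply: (@le_trans _ _ ((1 + eps / 2) ^+ 2 * (mnorm (r k) / mnorm (r 0%N)) ^+ 2)).
    apply: value_ratio_bound => //; rewrite ?mnorm_ge0 //.
      by have := value' k; rewrite ler_norml => /andP[_]; lra.
    by have := value' 0%N; rewrite ler_norml => /andP[+ _]; lra.
  rewrite ler_wpM2l ?sqr_ge0 // mulnC exprM.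
  by rewrite ler_pXn2r ?nnegrE ?divr_ge0 ?mnorm_ge0 ?exprn_ge0 // ratio_le.
Qed.
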